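(* The system $\mathsf{RCA}_0^\omega$ proves $\mathsf{Arz}\to\mathsf{NIN}$, where $\mathsf{Arz}$ is Arzelà's convergence theorem for the Riemann integral: let $f$ and $(f_n)_{n\in\mathbb{N}}$ be Riemann integrable functions on $[0,1]$ such that $\lim_{n\to\infty}f_n(x)=f(x)$ for all $x\in[0,1]$; if there is $M\in\mathbb{N}$ such that $|f_n(x)|\le M+1$ for all $n\in\mathbb{N}$ and $x\in[0,1]$, then $\lim_{n\to\infty}\int_0^1 f_n(x)\,dx=\int_0^1 f(x)\,dx$; and $\mathsf{NIN}$ is the statement: for any $Y:[0,1]\to\mathbb{N}$ there are $x,y\in[0,1]$ with $x\neq_{\mathbb{R}}y$ and $Y(x)=Y(y)$.
   Context: Finite types: $0$ is a type (natural numbers), and if $\sigma,\tau$ are types then so is $\sigma\to\tau$; $1:=0\to 0$ and $n+1:=n\to 0$; superscripts indicate types. $\mathsf{L}_\omega$ is the many-sorted language with variables of every finite type, constants $0,1,<_0,+_0,\times_0,=_0$ (with usual meaning), typed combinators $\Pi,\Sigma$, and recursor constants $\mathbf{R}_\sigma$. For $\tau=(\tau_1\to\dots\to\tau_k\to 0)$, $x=_\tau y$ abbreviates $\forall z_1^{\tau_1}\dots z_k^{\tau_k}(xz_1\dots z_k=_0 yz_1\dots z_k)$. $\mathsf{QF\text{-}AC}^{\sigma,\tau}$ is the schema $(\forall x^\sigma)(\exists y^\tau)A(x,y)\to(\exists Y^{\sigma\to\tau})(\forall x^\sigma)A(x,Y(x))$ for quantifier-free $A$ of $\mathsf{L}_\omega$.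 $\mathsf{RCA}_0^\omega$ (Kohlenbach's base theory, classical logic) has the following axioms: ordered semi-ring axioms for $0,1,<_0,+_0,\times_0$; defining axioms of $\Pi,\Sigma$ (giving $\lambda$-abstraction); $\mathbf{R}_0(f,m,0)=m$ and $\mathbf{R}_0(f,m,n+1)=f(n,\mathbf{R}_0(f,m,n))$; extensionality $x=_\rho y\to\varphi(x)=_\tau\varphi(y)$ for all types $\rho,\tau$; induction for quantifier-free formulas of $\mathsf{L}_\omega$; and $\mathsf{QF\text{-}AC}^{1,0}$. Finite sequences are coded as usual. Inside this theory a real is a sequence of rationals $(q_n)$ with $|q_n-q_{n+i}|<2^{-n}$ for all $n,i$; reals $x,y$ represented by $(q_n),(r_n)$ satisfy $x=_{\mathbb{R}}y$ iff $|q_n-r_n|\le 2^{-n+1}$ for all $n$. Functions on $[0,1]$ or $\mathbb{R}$ with values in $\mathbb{N}$ or $\mathbb{R}$ are objects of the corresponding finite type that map $=_{\mathbb{R}}$-equal reals to equal values. Riemann integrability and the Riemann integral have their usual $\varepsilon$-$\delta$ definition (via Riemann sums over tagged partitions), for arbitrary third-order functions. *)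

(* Defs.v *)
From Stdlib Require Import List.
Import ListNotations.

Set Implicit Arguments.
Unset Strict Implicit.
Unset Printing Implicit Defensive.

(** * Finite types and the language L_omega *)

Inductive ty : Type :=
| N : ty
| Arr : ty -> ty -> ty.

Notation "s ⇒ t" := (Arr s t) (at level 61, right associativity).

(* Type 1, i.e. 0 -> 0. *)
Notation T1 := (N ⇒ N).

(* Typed de Bruijn variables: contexts are lists of types, and every term and
   formula carries the context of its free variables. *)
Inductive var : list ty -> ty -> Type :=
| VZ : forall G s, var (s :: G) s
| VS : forall G s t, var G s -> var (t :: G) s.

Arguments VZ {G s}.
Arguments VS {G s t} _.

Inductive const : ty -> Type :=
| cZero : const N
| cOne : const N
| cPlus : const (N ⇒ N ⇒ N)
| cTimes : const (N ⇒ N ⇒ N)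
| cPi : forall s t, const (s ⇒ t ⇒ s)
| cSigma : forall r s t, const ((r ⇒ s ⇒ t) ⇒ (r ⇒ s) ⇒ r ⇒ t)
| cRec : forall s, const ((N ⇒ s ⇒ s) ⇒ s ⇒ N ⇒ s).

Inductive tm (G : list ty) : ty -> Type :=
| tVar : forall s, var G s -> tm G s
| tCon : forall s, const s -> tm G s
| tApp : forall s t, tm G (s ⇒ t) -> tm G s -> tm G t.

Arguments tVar {G s} _.
Arguments tCon {G s} _.
Arguments tApp {G s t} _ _.

(* The symbols =_0 and <_0 are binary predicates on type 0. *)
Inductive fm (G : list ty) : Type :=
| fEq : tm G N -> tm G N -> fm G
| fLt : tm G N -> tm G N -> fm G
| fBot : fm G
| fImp : fm G -> fm G -> fm G
| fAnd : fm G -> fm G -> fm G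
| fOr : fm G -> fm G -> fm G
| fAll : forall s, fm (s :: G) -> fm G
| fEx : forall s, fm (s :: G) -> fm G.

Arguments fBot {G}.
Arguments fAll {G} s _.
Arguments fEx {G} s _.

Definition fNot {G} (A : fm G) : fm G := fImp A fBot.

Declare Scope lomega_scope.
Open Scope lomega_scope.

Notation "#0" := (tVar VZ) : lomega_scope.
Notation "#1" := (tVar (VS VZ)) : lomega_scope.
Notation "#2" := (tVar (VS (VS VZ))) : lomega_scope.
Notation "#3" := (tVar (VS (VS (VS VZ)))) : lomega_scope.
Notation "#4" := (tVar (VS (VS (VS (VS VZ))))) : lomega_scope.
Notation "#5" := (tVar (VS (VS (VS (VS (VS VZ)))))) : lomega_scope.

Notation "s · t" := (tApp s t) (at level 28, left associativity) : lomega_scope.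
Notation "s ⊗ t" := (tCon cTimes · s · t)
  (at level 40, left associativity) : lomega_scope.
Notation "s ⊕ t" := (tCon cPlus · s · t)
  (at level 50, left associativity) : lomega_scope.
Notation "𝟎" := (tCon cZero) : lomega_scope.
Notation "𝟏" := (tCon cOne) : lomega_scope.

Notation "s ≐ t" := (fEq s t) (at level 70) : lomega_scope.
Notation "s ≺ t" := (fLt s t) (at level 70) : lomega_scope.
Notation "s ≼ t" := (fNot (fLt t s)) (at level 70) : lomega_scope.
Notation "⊥" := fBot : lomega_scope.
Notation "¬ A" := (fNot A) (at level 75, right associativity) : lomega_scope.
Notation "A ⋏ B" := (fAnd A B) (at level 80, right associativity) : lomega_scope.
Notation "A ⋎ B" := (fOr A B) (at level 85, right associativity) : lomega_scope.
Notation "A ⊃ B" := (fImp A B) (at level 90, right associativity) : lomega_scope.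
Notation "'∀[' s ] A" := (fAll s A)
  (at level 95, A at level 95, right associativity) : lomega_scope.
Notation "'∃[' s ] A" := (fEx s A)
  (at level 95, A at level 95, right associativity) : lomega_scope.

(** * Renaming and substitution *)

Definition renaming (G D : list ty) := forall s, var G s -> var D s.
Definition substitution (G D : list ty) := forall s, var G s -> tm D s.

Definition up_ren {G D t} (r : renaming G D) : renaming (t :: G) (t :: D) :=
  fun s v =>
    match v in var G' s' return
      match G' with
      | [] => unit
      | t' :: G0 => renaming G0 D -> var (t' :: D) s'
      end
    with
    | VZ => fun _ => VZ
    | VS w => fun r0 => VS (r0 _ w)
    end r.

Fixpoint ren_tm {G D s} (r : renaming G D) (a : tm G s) : tm D s :=
  match a with
  | tVar v => tVar (r _ v)
  | tCon c => tCon c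
  | tApp b c => tApp (ren_tm r b) (ren_tm r c)
  end.

Fixpoint ren_fm {G D} (r : renaming G D) (A : fm G) : fm D :=
  match A with
  | fEq a b => fEq (ren_tm r a) (ren_tm r b)
  | fLt a b => fLt (ren_tm r a) (ren_tm r b)
  | fBot => fBot
  | fImp B C => fImp (ren_fm r B) (ren_fm r C)
  | fAnd B C => fAnd (ren_fm r B) (ren_fm r C)
  | fOr B C => fOr (ren_fm r B) (ren_fm r C)
  | fAll t B => fAll t (ren_fm (up_ren r) B)
  | fEx t B => fEx t (ren_fm (up_ren r) B)
  end.

Definition wk {G t s} (a : tm G s) : tm (t :: G) s := ren_tm (fun _ v => VS v) a.
Definition wk_fm {G t} (A : fm G) : fm (t :: G) := ren_fm (fun _ v => VS v) A.

Notation "a ↑" := (wk a) (at level 8, left associativity, format "a ↑") : lomega_scope.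

(* [scons a f] sends the most recent variable to [a] and the others through [f]. *)
Definition scons {G D t} (a : tm D t) (f : substitution G D) :
    substitution (t :: G) D :=
  fun s v =>
    match v in var G' s' return
      match G' with
      | [] => unit
      | t' :: G0 => tm D t' -> substitution G0 D -> tm D s'
      end
    with
    | VZ => fun a0 _ => a0
    | VS w => fun _ f0 => f0 _ w
    end a f.

Definition up_sub {G D t} (f : substitution G D) : substitution (t :: G) (t :: D) :=
  scons #0 (fun _ v => (f _ v)↑).

Fixpoint sub_tm {G D s} (f : substitution G D) (a : tm G s) : tm D s :=
  match a with
  | tVar v => f _ v
  | tCon c => tCon c
  | tApp b c => tApp (sub_tm f b) (sub_tm f c)
  end.

Fixpoint sub_fm {G D} (f : substitution G D) (A : fm G) : fm D :=
  match A with
  | fEq a b => fEq (sub_tm f a) (sub_tm f b)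
  | fLt a b => fLt (sub_tm f a) (sub_tm f b)
  | fBot => fBot
  | fImp B C => fImp (sub_fm f B) (sub_fm f C)
  | fAnd B C => fAnd (sub_fm f B) (sub_fm f C)
  | fOr B C => fOr (sub_fm f B) (sub_fm f C)
  | fAll t B => fAll t (sub_fm (up_sub f) B)
  | fEx t B => fEx t (sub_fm (up_sub f) B)
  end.

Definition inst {G t} (A : fm (t :: G)) (a : tm G t) : fm G :=
  sub_fm (scons a (fun _ v => tVar v)) A.

(** * Classical natural deduction *)

(* A theory lists its axioms in every context; an axiom with free variables
   stands for its universal closure. *)
Definition theory := forall G : list ty, fm G -> Prop.

Inductive derives (T : theory) : forall G : list ty, list (fm G) -> fm G -> Prop :=
| d_axiom : forall G H (A : fm G), T G A -> derives T H A
| d_hyp : forall G H (A : fm G), In A H -> derives T H A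
| d_dne : forall G H (A : fm G), derives T H (¬ ¬ A) -> derives T H A
| d_impI : forall G H (A B : fm G), derives T (A :: H) B -> derives T H (A ⊃ B)
| d_impE : forall G H (A B : fm G),
    derives T H (A ⊃ B) -> derives T H A -> derives T H B
| d_andI : forall G H (A B : fm G),
    derives T H A -> derives T H B -> derives T H (A ⋏ B)
| d_andE1 : forall G H (A B : fm G), derives T H (A ⋏ B) -> derives T H A
| d_andE2 : forall G H (A B : fm G), derives T H (A ⋏ B) -> derives T H B
| d_orI1 : forall G H (A B : fm G), derives T H A -> derives T H (A ⋎ B)
| d_orI2 : forall G H (A B : fm G), derives T H B -> derives T H (A ⋎ B)
| d_orE : forall G H (A B C : fm G),
    derives T H (A ⋎ B) -> derives T (A :: H) C -> derives T (B :: H) C ->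
    derives T H C
| d_allI : forall G H s (A : fm (s :: G)),
    derives T (map wk_fm H) A -> derives T H (∀[s] A)
| d_allE : forall G H s (A : fm (s :: G)) (a : tm G s),
    derives T H (∀[s] A) -> derives T H (inst A a)
| d_exI : forall G H s (A : fm (s :: G)) (a : tm G s),
    derives T H (inst A a) -> derives T H (∃[s] A)
| d_exE : forall G H s (A : fm (s :: G)) (C : fm G),
    derives T H (∃[s] A) -> derives T (A :: map wk_fm H) (wk_fm C) ->
    derives T H C.

Definition proves (T : theory) (A : fm []) : Prop := derives T [] A.

(** * The theory RCA_0^omega *)

Fixpoint qf {G} (A : fm G) : bool :=
  match A with
  | fEq _ _ | fLt _ _ | fBot => true
  | fImp B C | fAnd B C | fOr B C => andb (qf B) (qf C)
  | fAll _ _ | fEx _ _ => false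
  end.

Fixpoint eqT {G} (t : ty) : tm G t -> tm G t -> fm G :=
  match t with
  | N => fun a b => a ≐ b
  | s ⇒ u => fun a b => ∀[s] eqT (a↑ · #0) (b↑ · #0)
  end.

Arguments eqT {G t} _ _.

Definition rec0 {G} (f : tm G (N ⇒ N ⇒ N)) (m n : tm G N) : tm G N :=
  tCon (cRec N) · f · m · n.

Inductive RCA0w : theory :=
(* equality axioms for =_0; congruence of application is part of extensionality *)
| ax_eq_refl : forall G (a : tm G N), RCA0w (a ≐ a)
| ax_eq_sym : forall G (a b : tm G N), RCA0w (a ≐ b ⊃ b ≐ a)
| ax_eq_trans : forall G (a b c : tm G N), RCA0w (a ≐ b ⊃ b ≐ c ⊃ a ≐ c)
| ax_eq_lt : forall G (a a' b b' : tm G N),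
    RCA0w (a ≐ a' ⊃ b ≐ b' ⊃ a ≺ b ⊃ a' ≺ b')
(* commutative ordered semi-ring; discreteness and 0 <= x follow by induction *)
| ax_add_assoc : forall G (a b c : tm G N), RCA0w (a ⊕ (b ⊕ c) ≐ a ⊕ b ⊕ c)
| ax_add_comm : forall G (a b : tm G N), RCA0w (a ⊕ b ≐ b ⊕ a)
| ax_add_0 : forall G (a : tm G N), RCA0w (a ⊕ 𝟎 ≐ a)
| ax_mul_assoc : forall G (a b c : tm G N), RCA0w (a ⊗ (b ⊗ c) ≐ a ⊗ b ⊗ c)
| ax_mul_comm : forall G (a b : tm G N), RCA0w (a ⊗ b ≐ b ⊗ a)
| ax_mul_0 : forall G (a : tm G N), RCA0w (a ⊗ 𝟎 ≐ 𝟎)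
| ax_mul_1 : forall G (a : tm G N), RCA0w (a ⊗ 𝟏 ≐ a)
| ax_distr : forall G (a b c : tm G N), RCA0w (a ⊗ (b ⊕ c) ≐ a ⊗ b ⊕ a ⊗ c)
| ax_lt_irrefl : forall G (a : tm G N), RCA0w (¬ (a ≺ a))
| ax_lt_trans : forall G (a b c : tm G N), RCA0w (a ≺ b ⊃ b ≺ c ⊃ a ≺ c)
| ax_lt_total : forall G (a b : tm G N), RCA0w (a ≺ b ⋎ a ≐ b ⋎ b ≺ a)
| ax_lt_add : forall G (a b c : tm G N), RCA0w (a ≺ b ⊃ a ⊕ c ≺ b ⊕ c)
| ax_lt_mul : forall G (a b c : tm G N),
    RCA0w (𝟎 ≺ c ⊃ a ≺ b ⊃ a ⊗ c ≺ b ⊗ c)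
| ax_lt_0_1 : forall G, RCA0w (G := G) (𝟎 ≺ 𝟏)
| ax_Pi : forall G s t (x : tm G s) (y : tm G t),
    RCA0w (eqT (tCon (cPi s t) · x · y) x)
| ax_Sigma : forall G r s t (x : tm G (r ⇒ s ⇒ t)) (y : tm G (r ⇒ s)) (z : tm G r),
    RCA0w (eqT (tCon (cSigma r s t) · x · y · z) (x · z · (y · z)))
(* recursor of type 0 only *)
| ax_rec_0 : forall G (f : tm G (N ⇒ N ⇒ N)) (m : tm G N),
    RCA0w (rec0 f m 𝟎 ≐ m)
| ax_rec_S : forall G (f : tm G (N ⇒ N ⇒ N)) (m n : tm G N),
    RCA0w (rec0 f m (n ⊕ 𝟏) ≐ f · n · rec0 f m n)
| ax_ext : forall G r t (x y : tm G r) (phi : tm G (r ⇒ t)),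
    RCA0w (eqT x y ⊃ eqT (phi · x) (phi · y))
| ax_ind : forall G (A : fm (N :: G)), qf A = true ->
    RCA0w (inst A 𝟎
           ⋏ (∀[N] A ⊃ sub_fm (scons (#0 ⊕ 𝟏) (fun _ v => tVar (VS v))) A)
           ⊃ (∀[N] A))
(* QF-AC^{1,0}; in [A], the variable #1 is x and #0 is y *)
| ax_qfac : forall G (A : fm (N :: T1 :: G)), qf A = true ->
    RCA0w ((∀[T1] ∃[N] A)
           ⊃ (∃[T1 ⇒ N] ∀[T1]
                sub_fm (scons (#1 · #0) (scons #0 (fun _ v => tVar (VS (VS v))))) A)).

(** * Lambda-abstraction by bracket abstraction *)

Definition lam_var {G s t} (v : var (s :: G) t) : tm G (s ⇒ t) :=
  match v in var G' t' return
    match G' with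
    | [] => unit
    | s' :: G0 => tm G0 (s' ⇒ t')
    end
  with
  | @VZ _ u => tCon (cSigma u (u ⇒ u) u) · tCon (cPi u (u ⇒ u)) · tCon (cPi u u)
  | VS w => tCon (cPi _ _) · tVar w
  end.

Fixpoint lam {G s t} (a : tm (s :: G) t) : tm G (s ⇒ t) :=
  match a in tm _ t' return tm G (s ⇒ t') with
  | tVar v => lam_var v
  | tCon c => tCon (cPi _ _) · tCon c
  | tApp b c => tCon (cSigma _ _ _) · lam b · lam c
  end.

(** * Arithmetic and coding of pairs *)

Definition c_pred {G} : tm G (N ⇒ N) := lam (rec0 (lam (lam #1)) 𝟎 #0).
Definition pred {G} (a : tm G N) : tm G N := c_pred · a.

Definition c_monus {G} : tm G (N ⇒ N ⇒ N) :=
  lam (lam (rec0 (lam (lam (pred #0))) #1 #0)).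
Definition monus {G} (a b : tm G N) : tm G N := c_monus · a · b.

Definition c_pow2 {G} : tm G (N ⇒ N) := lam (rec0 (lam (lam (#0 ⊕ #0))) 𝟏 #0).
Definition pow2 {G} (a : tm G N) : tm G N := c_pow2 · a.

(* [tri n] is 0 + 1 + ... + n. *)
Definition c_tri {G} : tm G (N ⇒ N) :=
  lam (rec0 (lam (lam (#0 ⊕ (#1 ⊕ 𝟏)))) 𝟎 #0).
Definition tri {G} (a : tm G N) : tm G N := c_tri · a.

(* Cantor's pairing (a, b) |-> tri (a + b) + b, with inverses [pfst], [psnd]. *)
Definition c_pair {G} : tm G (N ⇒ N ⇒ N) := lam (lam (tri (#1 ⊕ #0) ⊕ #0)).
Definition pair {G} (a b : tm G N) : tm G N := c_pair · a · b.

(* [root c] is the largest w with tri w <= c: at each step w is incremented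
   exactly when tri (w + 1) has been reached. *)
Definition c_root {G} : tm G (N ⇒ N) :=
  lam (rec0 (lam (lam (#0 ⊕ monus 𝟏 (monus (tri (#0 ⊕ 𝟏)) (#1 ⊕ 𝟏))))) 𝟎 #0).
Definition root {G} (a : tm G N) : tm G N := c_root · a.

Definition c_snd {G} : tm G (N ⇒ N) := lam (monus #0 (tri (root #0))).
Definition psnd {G} (a : tm G N) : tm G N := c_snd · a.
Definition c_fst {G} : tm G (N ⇒ N) := lam (monus (root #0) (psnd #0)).
Definition pfst {G} (a : tm G N) : tm G N := c_fst · a.

(** * Rational numbers *)

(* The code << a, b >, c > stands for the rational (a - b) / (c + 1); every
   natural number is the code of a rational.  [posQ], [negQ] return a and b. *)
Definition mkQ {G} (a b c : tm G N) : tm G N := pair (pair a b) c.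
Definition posQ {G} (q : tm G N) : tm G N := pfst (pfst q).
Definition negQ {G} (q : tm G N) : tm G N := psnd (pfst q).
Definition denQ {G} (q : tm G N) : tm G N := psnd q ⊕ 𝟏.

Definition ltQ {G} (q r : tm G N) : fm G :=
  posQ q ⊗ denQ r ⊕ negQ r ⊗ denQ q ≺ posQ r ⊗ denQ q ⊕ negQ q ⊗ denQ r.
Definition leQ {G} (q r : tm G N) : fm G := ¬ ltQ r q.

Definition c_addQ {G} : tm G (N ⇒ N ⇒ N) :=
  lam (lam (mkQ (posQ #1 ⊗ denQ #0 ⊕ posQ #0 ⊗ denQ #1)
                (negQ #1 ⊗ denQ #0 ⊕ negQ #0 ⊗ denQ #1)
                (pred (denQ #1 ⊗ denQ #0)))).
Definition addQ {G} (q r : tm G N) : tm G N := c_addQ · q · r.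

Definition c_oppQ {G} : tm G (N ⇒ N) := lam (mkQ (negQ #0) (posQ #0) (psnd #0)).
Definition subQ {G} (q r : tm G N) : tm G N := addQ q (c_oppQ · r).

Definition c_mulQ {G} : tm G (N ⇒ N ⇒ N) :=
  lam (lam (mkQ (posQ #1 ⊗ posQ #0 ⊕ negQ #1 ⊗ negQ #0)
                (posQ #1 ⊗ negQ #0 ⊕ negQ #1 ⊗ posQ #0)
                (pred (denQ #1 ⊗ denQ #0)))).
Definition mulQ {G} (q r : tm G N) : tm G N := c_mulQ · q · r.

Definition c_absQ {G} : tm G (N ⇒ N) :=
  lam (mkQ (monus (posQ #0) (negQ #0) ⊕ monus (negQ #0) (posQ #0))
           𝟎 (psnd #0)).
Definition absQ {G} (q : tm G N) : tm G N := c_absQ · q.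

(* m / 2^n *)
Definition dyadic {G} (m n : tm G N) : tm G N := mkQ m 𝟎 (pred (pow2 n)).

(** * Real numbers *)

Definition is_real {G} (x : tm G T1) : fm G :=
  ∀[N] ∀[N] ltQ (absQ (subQ (x↑↑ · #1) (x↑↑ · (#1 ⊕ #0)))) (dyadic 𝟏 #1).

Definition eqR {G} (x y : tm G T1) : fm G :=
  ∀[N] leQ (absQ (subQ (x↑ · #0) (y↑ · #0))) (dyadic (𝟏 ⊕ 𝟏) #0).

Definition leR {G} (x y : tm G T1) : fm G :=
  ∀[N] leQ (x↑ · #0) (addQ (y↑ · #0) (dyadic (𝟏 ⊕ 𝟏) #0)).

Definition ltR {G} (x y : tm G T1) : fm G := ¬ leR y x.

Definition natR {G} (m : tm G N) : tm G T1 := lam (mkQ m↑ 𝟎 𝟎).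

(* The index shifts below keep the sequences within the 2^{-n} rate. *)
Definition c_addR {G} : tm G (T1 ⇒ T1 ⇒ T1) :=
  lam (lam (lam (addQ (#2 · (#0 ⊕ 𝟏)) (#1 · (#0 ⊕ 𝟏))))).
Definition addR {G} (x y : tm G T1) : tm G T1 := c_addR · x · y.

Definition c_oppR {G} : tm G (T1 ⇒ T1) := lam (lam (c_oppQ · (#1 · #0))).
Definition subR {G} (x y : tm G T1) : tm G T1 := addR x (c_oppR · y).

Definition c_absR {G} : tm G (T1 ⇒ T1) := lam (lam (absQ (#1 · #0))).
Definition absR {G} (x : tm G T1) : tm G T1 := c_absR · x.

(* A natural number above |q|. *)
Definition boundQ {G} (q : tm G N) : tm G N := posQ q ⊕ negQ q ⊕ 𝟏.

(* (x y)_n = x_{n+k} y_{n+k} with k >= |x_0| + |y_0| + 2. *)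
Definition c_mulR {G} : tm G (T1 ⇒ T1 ⇒ T1) :=
  lam (lam (lam
    (mulQ (#2 · (#0 ⊕ (boundQ (#2 · 𝟎) ⊕ boundQ (#1 · 𝟎))))
          (#1 · (#0 ⊕ (boundQ (#2 · 𝟎) ⊕ boundQ (#1 · 𝟎))))))).
Definition mulR {G} (x y : tm G T1) : tm G T1 := c_mulR · x · y.

(* z_0 + ... + z_{k-1}; its n-th approximation is the sum over i < k of the
   rationals (z_i)_{n+k}. *)
Definition c_sumR {G} : tm G ((N ⇒ T1) ⇒ N ⇒ T1) :=
  lam (lam (lam
    (rec0 (lam (lam (addQ #0 (#4 · #1 · (#2 ⊕ #3))))) (mkQ 𝟎 𝟎 𝟎) #1))).
Definition sumR {G} (z : tm G (N ⇒ T1)) (k : tm G N) : tm G T1 := c_sumR · z · k.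

Definition pos_real {G} (x : tm G T1) : fm G := is_real x ⋏ ltR (natR 𝟎) x.

Definition in01 {G} (x : tm G T1) : fm G :=
  is_real x ⋏ leR (natR 𝟎) x ⋏ leR x (natR 𝟏).

(* f : [0,1] -> R *)
Definition real_fun {G} (f : tm G (T1 ⇒ T1)) : fm G :=
  (∀[T1] in01 #0 ⊃ is_real (f↑ · #0))
  ⋏ (∀[T1] ∀[T1] in01 #1 ⋏ in01 #0 ⋏ eqR #1 #0 ⊃ eqR (f↑↑ · #1) (f↑↑ · #0)).

(* Y : [0,1] -> N *)
Definition nat_fun {G} (Y : tm G (T1 ⇒ N)) : fm G :=
  ∀[T1] ∀[T1] in01 #1 ⋏ in01 #0 ⋏ eqR #1 #0 ⊃ Y↑↑ · #1 ≐ Y↑↑ · #0.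

(** * The Riemann integral *)

(* 0 = x_0 < x_1 < ... < x_k = 1 with tags t_i in [x_i, x_{i+1}] for i < k;
   the values of x beyond k and of t from k on are irrelevant. *)
Definition tagged_partition {G} (x t : tm G (N ⇒ T1)) (k : tm G N) : fm G :=
  eqR (x · 𝟎) (natR 𝟎) ⋏ eqR (x · k) (natR 𝟏)
  ⋏ (∀[N] #0 ≼ k↑ ⊃ in01 (x↑ · #0))
  ⋏ (∀[N] #0 ≺ k↑ ⊃
       ltR (x↑ · #0) (x↑ · (#0 ⊕ 𝟏))
       ⋏ in01 (t↑ · #0) ⋏ leR (x↑ · #0) (t↑ · #0) ⋏ leR (t↑ · #0) (x↑ · (#0 ⊕ 𝟏))).

Definition mesh_lt {G} (x : tm G (N ⇒ T1)) (k : tm G N) (d : tm G T1) : fm G :=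
  ∀[N] #0 ≺ k↑ ⊃ ltR (subR (x↑ · (#0 ⊕ 𝟏)) (x↑ · #0)) d↑.

Definition riemann_sum {G} (f : tm G (T1 ⇒ T1)) (x t : tm G (N ⇒ T1)) (k : tm G N) :
    tm G T1 :=
  sumR (lam (mulR (f↑ · (t↑ · #0)) (subR (x↑ · (#0 ⊕ 𝟏)) (x↑ · #0)))) k.

Definition is_integral {G} (f : tm G (T1 ⇒ T1)) (J : tm G T1) : fm G :=
  is_real J
  ⋏ (∀[T1] pos_real #0 ⊃
      (∃[T1] pos_real #0
        ⋏ (∀[N ⇒ T1] ∀[N ⇒ T1] ∀[N]
             (* from #4 to #0: epsilon, delta, points, tags, number of intervals *)
             tagged_partition #2 #1 #0 ⋏ mesh_lt #2 #0 #3 ⊃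
             ltR (absR (subR (riemann_sum f↑↑↑↑↑ #2 #1 #0) J↑↑↑↑↑)) #4))).

Definition integrable {G} (f : tm G (T1 ⇒ T1)) : fm G := ∃[T1] is_integral f↑ #0.

(** * Arzela's theorem and NIN *)

Definition pointwise_lim {G} (F : tm G (N ⇒ T1 ⇒ T1)) (f : tm G (T1 ⇒ T1)) : fm G :=
  ∀[T1] in01 #0 ⊃
    (∀[T1] pos_real #0 ⊃
      (∃[N] ∀[N] #1 ≼ #0 ⊃
         ltR (absR (subR (F↑↑↑↑ · #0 · #3) (f↑↑↑↑ · #3))) #2)).

Definition bounded_by {G} (F : tm G (N ⇒ T1 ⇒ T1)) (M : tm G N) : fm G :=
  ∀[N] ∀[T1] in01 #0 ⊃ leR (absR (F↑↑ · #1 · #0)) (natR (M↑↑ ⊕ 𝟏)).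

(* The integral is a real determined up to =_R; a sequence of integrals need not
   be given as an object, so the limit is stated for all values of the integrals. *)
Definition integrals_lim {G} (F : tm G (N ⇒ T1 ⇒ T1)) (f : tm G (T1 ⇒ T1)) : fm G :=
  ∀[T1] is_integral f↑ #0 ⊃
    (∀[T1] pos_real #0 ⊃
      (∃[N] ∀[N] #1 ≼ #0 ⊃
        (∀[T1] is_integral (F↑↑↑↑↑ · #1) #0 ⊃ ltR (absR (subR #0 #4)) #3))).

Definition Arz : fm [] :=
  ∀[T1 ⇒ T1] ∀[N ⇒ T1 ⇒ T1]
    (real_fun #1 ⋏ integrable #1)
    ⋏ (∀[N] real_fun (#1 · #0) ⋏ integrable (#1 · #0))
    ⋏ pointwise_lim #0 #1
    ⊃ (∃[N] bounded_by #1 #0)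
    ⊃ integrals_lim #0 #1.

Definition NIN : fm [] :=
  ∀[T1 ⇒ N] nat_fun #0 ⊃
    (∃[T1] ∃[T1] in01 #1 ⋏ in01 #0 ⋏ ¬ eqR #1 #0 ⋏ #2 · #1 ≐ #2 · #0).

(* Main.v *)
(** By completeness of many-sorted classical logic it is enough to argue in an
    arbitrary model of the theory, which may be taken extensional; its numbers
    form an ordered semiring with induction for quantifier-free predicates.

    In such a model let [Y] be injective on [0,1] up to equality of reals, and
    let [f_n] be the indicator function of [{x | Y x <= n}].  Then [f_n]
    converges pointwise to the constant 1.  Two equal tags of a partition lie in
    adjacent intervals, so each value of [Y] is taken by at most three tags, and
    a Riemann sum of [f_n] for a partition of mesh [d] is at most [3 (n + 1) d].
    Hence [f_n] has integral 0 for every [n], which contradicts Arzela's theorem.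

    Every induction is on a quantifier-free formula because the relations
    between reals are only ever compared at one fixed precision, up to an
    explicit error. *)

Require Import Defs.
From HB Require Import structures.
From mathcomp Require Import all_boot order ssralg ssrnum.
From mathcomp Require Import boolp.
From mathcomp Require Import ring lra.
From Stdlib Require Import List.
Import ListNotations.
Import Defs.

Set Implicit Arguments.
Unset Strict Implicit.
Unset Printing Implicit Defensive.
Unset Asymmetric Patterns.

(** * Substitution *)

(** The obstacle is that the numbers of the model may be nonstandard. A partition can then have a
    nonstandard number of intervals, so neither the Riemann sums nor the counting of tags can be
    done with finite sums of the metatheory: a sum is a value of the internal recursor, and every
    bound on it comes from an induction inside the model. Every function that occurs in such an
    induction is therefore exhibited as a term with parameters, and rationals are the elements of
    the field of fractions of the numbers of the model, each of which has a code.

    A strict inequality of reals hides an existential quantifier over precisions. It is replaced by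
    a rational gap that persists at all precisions, and only then is a precision chosen, so fine
    that even nonstandardly many rounding errors stay below the gap. For a sum of k reals this is
    paid for by its evaluation at precision n + k, since k < 2^k.

    The factor 3 counts the indices i - 1, i, i + 1 that can share a value with index i, and n + 1
    counts the values 0, ..., n. *)

Lemma var_case (t : ty) (G : list ty) (P : forall s, var (t :: G) s -> Prop) :
  P t VZ -> (forall s (v : var G s), P s (VS v)) -> forall s v, P s v.
Proof.
move=> hz hs s v.
exact: (match v as v' in var G' s' return
  match G' return var G' s' -> Prop with
  | [] => fun _ => True
  | t' :: G0 => fun v' => forall P : forall s, var (t' :: G0) s -> Prop,
      P t' VZ -> (forall s (v : var G0 s), P s (VS v)) -> P s' v'
  end v' with VZ => fun _ h _ => h | VS w => fun _ _ h => h _ w end P hz hs).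
Qed.

Lemma var_nil (s : ty) (v : var [] s) : False.
Proof. by inversion v. Qed.

Lemma scons_eta (D G : list ty) (t : ty) (f : substitution (t :: G) D) :
  scons (f t VZ) (fun s v => f s (VS v)) = f.
Proof.
apply: functional_extensionality_dep => s; apply: functional_extensionality_dep => v.
by apply: (var_case (P := fun s v => scons _ _ v = f s v)).
Qed.

(** Substitutions are functions, so functional extensionality turns pointwise agreement into
    equality. Equalities between substitution instances below are reduced to this by [congr]. *)
Lemma sub_ext (D G : list ty) (t : ty) (f g : substitution (t :: G) D) :
    f t VZ = g t VZ -> (forall s (v : var G s), f s (VS v) = g s (VS v)) -> f = g.
Proof.
move=> hz hs; rewrite -(scons_eta f) -(scons_eta g) hz; congr scons.
by do 2 apply: functional_extensionality_dep => ?.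
Qed.

Lemma sub_nil_ext (D : list ty) (f g : substitution [] D) : f = g.
Proof.
apply: functional_extensionality_dep => s; apply: functional_extensionality_dep => v.
by case: (var_nil v).
Qed.

(** Terms have no binders, so this is a plain induction; for formulas the lifting under a quantifier
    has to be treated by [up_sub_comp]. *)
Lemma sub_tm_comp (G D E : list ty) (f : substitution G D) (g : substitution D E)
    (s : ty) (a : tm G s) :
  sub_tm g (sub_tm f a) = sub_tm (fun s v => sub_tm g (f s v)) a.
Proof. by elim: a => //= s' t b -> c ->. Qed.

Lemma ren_tmE (G D : list ty) (r : renaming G D) (s : ty) (a : tm G s) :
  ren_tm r a = sub_tm (fun s v => tVar (r s v)) a.
Proof. by elim: a => //= s' t b -> c ->. Qed.

Lemma wkE (G : list ty) (t s : ty) (a : tm G s) :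
  wk a = sub_tm (fun s v => tVar (VS (t:=t) v)) a.
Proof. exact: ren_tmE. Qed.

Lemma sub_tm_id (G : list ty) (s : ty) (a : tm G s) : sub_tm (fun s v => tVar v) a = a.
Proof. by elim: a => //= s' t b -> c ->. Qed.

Lemma up_sub_id (G : list ty) (t : ty) :
  up_sub (t := t) (fun s (v : var G s) => tVar v) = fun s v => tVar v.
Proof. exact: sub_ext. Qed.

Lemma sub_tm_scons (G D : list ty) (t : ty) (b : tm D t) (f : substitution G D)
    (s : ty) (a : tm G s) :
  sub_tm (scons b f) (wk a) = sub_tm f a.
Proof. by rewrite wkE sub_tm_comp. Qed.

Lemma sub_tm_up (G D : list ty) (t : ty) (f : substitution G D) (s : ty) (a : tm G s) :
  sub_tm (up_sub (t := t) f) (wk a) = wk (sub_tm f a).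
Proof.
rewrite !wkE !sub_tm_comp; congr sub_tm.
by do 2 apply: functional_extensionality_dep => ?; rewrite -wkE.
Qed.

Lemma up_sub_comp (G D E : list ty) (t : ty) (f : substitution G D) (g : substitution D E) :
  (fun s v => sub_tm (up_sub (t := t) g) (@up_sub _ _ t f s v)) =
  up_sub (fun s v => sub_tm g (f s v)).
Proof. by apply: sub_ext => // s v; rewrite /= sub_tm_up. Qed.

Lemma sub_fm_comp (G : list ty) (A : fm G) (D E : list ty) (f : substitution G D)
    (g : substitution D E) :
  sub_fm g (sub_fm f A) = sub_fm (fun s v => sub_tm g (f s v)) A.
Proof.
elim: A D E f g => //= {G}.
- by move=> G a b D E f g; rewrite !sub_tm_comp.
- by move=> G a b D E f g; rewrite !sub_tm_comp.
- by move=> G A hA B hB D E f g; rewrite hA hB.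
- by move=> G A hA B hB D E f g; rewrite hA hB.
- by move=> G A hA B hB D E f g; rewrite hA hB.
- by move=> G s A hA D E f g; rewrite hA up_sub_comp.
- by move=> G s A hA D E f g; rewrite hA up_sub_comp.
Qed.

Lemma up_renE (G D : list ty) (t : ty) (r : renaming G D) :
  (fun s v => tVar (@up_ren _ _ t r s v)) = up_sub (fun s v => tVar (r s v)).
Proof. exact: sub_ext. Qed.

Lemma ren_fmE (G : list ty) (A : fm G) (D : list ty) (r : renaming G D) :
  ren_fm r A = sub_fm (fun s v => tVar (r s v)) A.
Proof.
elim: A D r => //= {G}.
- by move=> G a b D r; rewrite !ren_tmE.
- by move=> G a b D r; rewrite !ren_tmE.
- by move=> G A hA B hB D r; rewrite hA hB.
- by move=> G A hA B hB D r; rewrite hA hB.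
- by move=> G A hA B hB D r; rewrite hA hB.
- by move=> G s A hA D r; rewrite hA up_renE.
- by move=> G s A hA D r; rewrite hA up_renE.
Qed.

Lemma wk_fmE (G : list ty) (t : ty) (A : fm G) :
  wk_fm A = sub_fm (fun s v => tVar (VS (t:=t) v)) A.
Proof. exact: ren_fmE. Qed.

Lemma sub_fm_id (G : list ty) (A : fm G) : sub_fm (fun s v => tVar v) A = A.
Proof.
elim: A => //= {G}.
- by move=> G a b; rewrite !sub_tm_id.
- by move=> G a b; rewrite !sub_tm_id.
- by move=> G A hA B hB; rewrite hA hB.
- by move=> G A hA B hB; rewrite hA hB.
- by move=> G A hA B hB; rewrite hA hB.
- by move=> G s A hA; rewrite up_sub_id hA.
- by move=> G s A hA; rewrite up_sub_id hA.
Qed.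

Lemma sub_fm_scons (G D : list ty) (t : ty) (b : tm D t) (f : substitution G D) (A : fm G) :
  sub_fm (scons b f) (wk_fm A) = sub_fm f A.
Proof. by rewrite wk_fmE sub_fm_comp. Qed.

Lemma inst_wk_fm (G : list ty) (t : ty) (A : fm G) (a : tm G t) : inst (wk_fm A) a = A.
Proof. by rewrite /inst sub_fm_scons sub_fm_id. Qed.

Lemma sub_fm_up (G D : list ty) (t : ty) (f : substitution G D) (A : fm G) :
  sub_fm (up_sub (t := t) f) (wk_fm A) = wk_fm (sub_fm f A).
Proof.
rewrite !wk_fmE !sub_fm_comp; congr sub_fm.
by do 2 apply: functional_extensionality_dep => ?; rewrite /= wkE.
Qed.

Lemma sub_fm_inst (G D : list ty) (t : ty) (f : substitution G D) (A : fm (t :: G))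
    (a : tm G t) :
  sub_fm f (inst A a) = inst (sub_fm (up_sub f) A) (sub_tm f a).
Proof.
rewrite /inst !sub_fm_comp; congr sub_fm.
by apply: sub_ext => //= s v; rewrite sub_tm_scons sub_tm_id.
Qed.

Lemma inst_up_ren (G : list ty) (t : ty) (A : fm (t :: G)) :
  inst (ren_fm (up_ren (fun _ v => VS v)) A) #0 = A.
Proof.
rewrite /inst ren_fmE sub_fm_comp -[RHS]sub_fm_id; congr sub_fm.
exact: sub_ext.
Qed.

(** * Derivations under substitution and weakening *)

Definition sub_closed (T : theory) :=
  forall G D (f : substitution G D) (A : fm G), T G A -> T D (sub_fm f A).

Lemma map_sub_wk (G D : list ty) (t : ty) (f : substitution G D) (H : list (fm G)) :
  map (sub_fm (up_sub (t := t) f)) (map wk_fm H) = map wk_fm (map (sub_fm f) H).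
Proof. by rewrite !map_map; apply: map_ext => A; rewrite sub_fm_up. Qed.

Lemma derives_sub (T : theory) (G : list ty) (H : list (fm G)) (A : fm G) :
    sub_closed T -> derives T H A ->
  forall D (f : substitution G D), derives T (map (sub_fm f) H) (sub_fm f A).
Proof.
move=> hT; elim=> {G H A}.
- by move=> G H A hA D f; apply: d_axiom; exact: hT.
- by move=> G H A hA D f; apply: d_hyp; exact: in_map.
- by move=> G H A _ h D f; apply: d_dne; exact: h.
- by move=> G H A B _ h D f; apply: d_impI; exact: h.
- by move=> G H A B _ h _ h' D f; exact: d_impE (h _ f) (h' _ f).
- by move=> G H A B _ h _ h' D f; exact: d_andI (h _ f) (h' _ f).
- by move=> G H A B _ h D f; exact: d_andE1 (h _ f).
- by move=> G H A B _ h D f; exact: d_andE2 (h _ f).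
- by move=> G H A B _ h D f; exact: d_orI1 (h _ f).
- by move=> G H A B _ h D f; exact: d_orI2 (h _ f).
- by move=> G H A B C _ h _ h1 _ h2 D f; exact: d_orE (h _ f) (h1 _ f) (h2 _ f).
- by move=> G H s A _ h D f; apply: d_allI; rewrite -map_sub_wk; exact: h.
- by move=> G H s A a _ h D f; rewrite sub_fm_inst; apply: d_allE; exact: h.
- move=> G H s A a _ h D f; apply: (d_exI (a := sub_tm f a)).
  by rewrite -sub_fm_inst; exact: h.
- move=> G H s A C _ h _ h' D f; apply: (d_exE (h _ f)).
  by rewrite -map_sub_wk -sub_fm_up; exact: h'.
Qed.

Lemma derives_incl (T : theory) (G : list ty) (H : list (fm G)) (A : fm G) :
  derives T H A -> forall H', incl H H' -> derives T H' A.
Proof.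
have inclS : forall G (A : fm G) H H', incl H H' -> incl (A :: H) (A :: H').
  by move=> *; apply: incl_cons; [left | apply: incl_tl].
elim=> {G H A}.
- by move=> G H A hA H' _; exact: d_axiom.
- by move=> G H A hA H' h; apply: d_hyp; exact: h.
- by move=> G H A _ h H' i; exact: d_dne (h _ i).
- by move=> G H A B _ h H' i; apply: d_impI; apply: h; exact: inclS.
- by move=> G H A B _ h _ h' H' i; exact: d_impE (h _ i) (h' _ i).
- by move=> G H A B _ h _ h' H' i; exact: d_andI (h _ i) (h' _ i).
- by move=> G H A B _ h H' i; exact: d_andE1 (h _ i).
- by move=> G H A B _ h H' i; exact: d_andE2 (h _ i).
- by move=> G H A B _ h H' i; exact: d_orI1 (h _ i).
- by move=> G H A B _ h H' i; exact: d_orI2 (h _ i).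
- by move=> G H A B C _ h _ h1 _ h2 H' i;
    apply: (d_orE (h _ i)); [apply: h1 | apply: h2]; exact: inclS.
- by move=> G H s A _ h H' i; apply: d_allI; apply: h; exact: incl_map.
- by move=> G H s A a _ h H' i; apply: d_allE; exact: h.
- by move=> G H s A a _ h H' i; exact: d_exI (h _ i).
- move=> G H s A C _ h _ h' H' i; apply: (d_exE (h _ i)).
  by apply: h'; apply: inclS; exact: incl_map.
Qed.

Lemma derives_wk (T : theory) (G : list ty) (t : ty) (H : list (fm G)) (A : fm G) :
  sub_closed T -> derives T H A -> derives T (map (wk_fm (t := t)) H) (wk_fm A).
Proof.
move=> hT h; rewrite wk_fmE (map_ext _ _ (@wk_fmE G t)).
exact: derives_sub.
Qed.

Lemma sub_eqT (t : ty) (G D : list ty) (f : substitution G D) (a b : tm G t) :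
  sub_fm f (eqT a b) = eqT (sub_tm f a) (sub_tm f b).
Proof.
elim: t G D f a b => //= s _ t ht G D f a b.
by rewrite ht /= !sub_tm_up.
Qed.

Lemma qf_sub (G : list ty) (A : fm G) (D : list ty) (f : substitution G D) :
  qf (sub_fm f A) = qf A.
Proof. by elim: A D f => //= {}G A hA B hB D f; rewrite hA hB. Qed.

(** Substitution keeps a formula quantifier-free, so an instance of induction or choice goes to an
    instance of the same schema, once the substitutions in its statement are commuted with [f]. *)
Lemma RCA0w_sub_closed : sub_closed RCA0w.
Proof.
move=> G D f A hA; case: hA D f => {G A} /=; try by move=> *; constructor.
- by move=> G s t x y D f; rewrite sub_eqT; exact: ax_Pi.
- by move=> G r s t x y z D f; rewrite sub_eqT; exact: ax_Sigma.
- by move=> G r t x y phi D f; rewrite !sub_eqT; exact: ax_ext.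
- move=> G A hA D f.
  have hq : qf (sub_fm (up_sub f) A) = true by rewrite qf_sub.
  have := ax_ind hq; congr (RCA0w (_ ⋏ (∀[N] _ ⊃ _) ⊃ _)).
  + by rewrite sub_fm_inst.
  + rewrite !sub_fm_comp; congr sub_fm.
    by apply: sub_ext => //= s v; rewrite sub_tm_scons wkE.
- move=> G A hA D f.
  have hq : qf (sub_fm (up_sub (up_sub f)) A) = true by rewrite qf_sub.
  have := ax_qfac hq; congr (RCA0w (_ ⊃ ∃[_] ∀[_] _)).
  rewrite !sub_fm_comp; congr sub_fm.
  apply: sub_ext => //=; apply: var_case => //= s v.
  by rewrite !sub_tm_scons !wkE sub_tm_comp.
Qed.

(** * Structures and satisfaction *)

(** Function types are interpreted by arbitrary sets with an application map, and [=_0] by an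
    arbitrary relation, so that families of terms form a structure at once. Equal elements are
    identified later, in [ext_quot]. *)
Record structure := Structure {
  dom : ty -> Type;
  app : forall s t, dom (s ⇒ t) -> dom s -> dom t;
  con : forall s, const s -> dom s;
  eq0 : dom N -> dom N -> Prop;
  lt0 : dom N -> dom N -> Prop }.

Arguments con {_ s} _.
Arguments app {_ s t} _ _.
Arguments eq0 {_} _ _.
Arguments lt0 {_} _ _.

Definition env (M : structure) (G : list ty) := forall s, var G s -> dom M s.

Definition enil {M : structure} : env M [] := fun s v => False_rect _ (var_nil v).

Definition econs {M G t} (x : dom M t) (r : env M G) : env M (t :: G) :=
  fun s v =>
    match v in var G' s' return
      match G' with
      | [] => unit
      | t' :: G0 => dom M t' -> env M G0 -> dom M s'
      end
    with
    | VZ => fun x0 _ => x0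
    | VS w => fun _ r0 => r0 _ w
    end x r.

Fixpoint eval {M G s} (r : env M G) (a : tm G s) : dom M s :=
  match a with
  | tVar v => r _ v
  | tCon c => con c
  | tApp b c => app (eval r b) (eval r c)
  end.

Fixpoint sat {M G} (r : env M G) (A : fm G) : Prop :=
  match A with
  | fEq a b => eq0 (eval r a) (eval r b)
  | fLt a b => lt0 (eval r a) (eval r b)
  | fBot => False
  | fImp B C => sat r B -> sat r C
  | fAnd B C => sat r B /\ sat r C
  | fOr B C => sat r B \/ sat r C
  | fAll t B => forall x : dom M t, sat (econs x r) B
  | fEx t B => exists x : dom M t, sat (econs x r) B
  end.

Definition models (M : structure) (T : theory) :=
  forall G (A : fm G) (r : env M G), T G A -> sat r A.

Lemma env_ext (M : structure) (G : list ty) (t : ty) (f g : env M (t :: G)) :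
    f t VZ = g t VZ -> (forall s (v : var G s), f s (VS v) = g s (VS v)) -> f = g.
Proof.
move=> hz hs; do 2 apply: functional_extensionality_dep => ?.
exact: (var_case (P := fun s v => f s v = g s v)).
Qed.

Lemma env_nil_ext (M : structure) (f g : env M []) : f = g.
Proof.
apply: functional_extensionality_dep => s; apply: functional_extensionality_dep => v.
by case: (var_nil v).
Qed.

Lemma eval_sub (M : structure) (G D : list ty) (f : substitution G D) (r : env M D) (s : ty)
    (a : tm G s) :
  eval r (sub_tm f a) = eval (fun s v => eval r (f s v)) a.
Proof. by elim: a => //= s' t b -> c ->. Qed.

Lemma eval_wk (M : structure) (G : list ty) (r : env M G) (t s : ty) (x : dom M t)
    (a : tm G s) :
  eval (econs x r) (wk a) = eval r a.
Proof. by rewrite wkE eval_sub. Qed.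

Lemma sat_sub (G : list ty) (A : fm G) (M : structure) (D : list ty) (f : substitution G D)
    (r : env M D) :
  sat r (sub_fm f A) <-> sat (fun s v => eval r (f s v)) A.
Proof.
have up : forall (G D : list ty) (t : ty) (f : substitution G D) (r : env M D) (x : dom M t),
    (fun s v => eval (econs x r) (@up_sub _ _ t f s v)) =
    econs x (fun s v => eval r (f s v)).
  by move=> *; apply: env_ext => //= s v; rewrite eval_wk.
elim: A D f r => //= {G}.
- by move=> G a b D f r; rewrite !eval_sub.
- by move=> G a b D f r; rewrite !eval_sub.
- by move=> G A hA B hB D f r; rewrite hA hB.
- by move=> G A hA B hB D f r; rewrite hA hB.
- by move=> G A hA B hB D f r; rewrite hA hB.
- by move=> G s A hA D f r; split=> h x; [rewrite -up -hA | rewrite hA up].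
- by move=> G s A hA D f r; split=> -[x h]; exists x; [rewrite -up -hA | rewrite hA up].
Qed.

(** * Countability of the language *)

(** The Henkin construction enumerates all existential formulas, for which an injection into the
    countable type of trees is enough. Type indices are not always stored in a code, hence the
    injectivity statements with [existT]. *)
Fixpoint ty_code (s : ty) : GenTree.tree nat :=
  match s with
  | N => GenTree.Leaf 0
  | Arr s t => GenTree.Node 0 [:: ty_code s; ty_code t]
  end.

Lemma ty_code_inj : injective ty_code.
Proof. by elim=> [|s hs t ht] [|s' t'] //= [/hs-> /ht->]. Qed.

(** An instance of uniqueness of identity proofs, here obtained from proof irrelevance. *)
Lemma existT_inj (I : Type) (P : I -> Type) (i : I) (a b : P i) :
  existT P i a = existT P i b -> a = b.
Proof.
by move=> e; have := projT2_eq e; rewrite (Prop_irrelevance (projT1_eq e) erefl).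
Qed.

Fixpoint var_code {G s} (v : var G s) : nat :=
  match v with VZ => 0 | VS w => (var_code w).+1 end.

Lemma var_code_inj (G : list ty) (s : ty) (v : var G s) (s' : ty) (w : var G s') :
  var_code v = var_code w -> existT (var G) s v = existT (var G) s' w.
Proof.
elim: v s' w => {G s} [G s | G s t v IH];
  apply: (var_case (P := fun s' w => var_code _ = var_code w -> existT _ _ _ = existT _ s' w)) => //=.
move=> s' w [/IH e].
exact: (f_equal (fun p => existT (var (t :: G)) (projT1 p) (VS (projT2 p))) e).
Qed.

Definition const_code (s : ty) (c : const s) : GenTree.tree nat :=
  match c with
  | cZero => GenTree.Leaf 0
  | cOne => GenTree.Leaf 1
  | cPlus => GenTree.Leaf 2
  | cTimes => GenTree.Leaf 3
  | cPi s t => GenTree.Node 0 [:: ty_code s; ty_code t]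
  | cSigma r s t => GenTree.Node 1 [:: ty_code r; ty_code s; ty_code t]
  | cRec s => GenTree.Node 2 [:: ty_code s]
  end.

Lemma const_code_inj (s : ty) (c : const s) (s' : ty) (d : const s') :
  const_code c = const_code d -> existT const s c = existT const s' d.
Proof.
case: c => [||||s1 t1|r1 s1 t1|s1]; case: d => [||||s2 t2|r2 s2 t2|s2] //=.
- by case=> /ty_code_inj-> /ty_code_inj->.
- by case=> /ty_code_inj-> /ty_code_inj-> /ty_code_inj->.
- by case=> /ty_code_inj->.
Qed.

Fixpoint tm_code {G s} (a : tm G s) : GenTree.tree nat :=
  match a with
  | tVar v => GenTree.Node 0 [:: GenTree.Leaf (var_code v)]
  | tCon c => GenTree.Node 1 [:: const_code c]
  | tApp b c => GenTree.Node 2 [:: tm_code b; tm_code c]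
  end.

Lemma tm_code_inj (G : list ty) (s : ty) (a : tm G s) (s' : ty) (b : tm G s') :
  tm_code a = tm_code b -> existT (tm G) s a = existT (tm G) s' b.
Proof.
elim: a s' b => {s} [s v|s c|s t a IHa c IHc] s' [s2 v2|s2 c2|s2 t2 a2 c2] //=.
- case=> /var_code_inj e.
  exact: (f_equal (fun p => existT (tm G) (projT1 p) (tVar (projT2 p))) e).
- case=> /const_code_inj e.
  exact: (f_equal (fun p => existT (tm G) (projT1 p) (tCon (projT2 p))) e).
- case=> /IHa ea /IHc ec.
  (* The code of an application does not store the argument type; it is read off from the type of
     the function part. *)
  have [es et] : s = s2 /\ t = t2 by have := projT1_eq ea; case.
  by subst; rewrite (existT_inj ea) (existT_inj ec).
Qed.

Fixpoint fm_code {G} (A : fm G) : GenTree.tree nat :=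
  match A with
  | fEq a b => GenTree.Node 0 [:: tm_code a; tm_code b]
  | fLt a b => GenTree.Node 1 [:: tm_code a; tm_code b]
  | fBot => GenTree.Leaf 0
  | fImp B C => GenTree.Node 2 [:: fm_code B; fm_code C]
  | fAnd B C => GenTree.Node 3 [:: fm_code B; fm_code C]
  | fOr B C => GenTree.Node 4 [:: fm_code B; fm_code C]
  | fAll t B => GenTree.Node 5 [:: ty_code t; fm_code B]
  | fEx t B => GenTree.Node 6 [:: ty_code t; fm_code B]
  end.

Lemma fm_code_inj (G : list ty) : injective (@fm_code G).
Proof.
elim=> {G} [G a b|G a b|G|G A hA B hB|G A hA B hB|G A hA B hB|G s A hA|G s A hA]
  [a2 b2|a2 b2||A2 B2|A2 B2|A2 B2|s2 A2|s2 A2] //=.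
- by case=> ha hb; rewrite (existT_inj (tm_code_inj ha)) (existT_inj (tm_code_inj hb)).
- by case=> ha hb; rewrite (existT_inj (tm_code_inj ha)) (existT_inj (tm_code_inj hb)).
- by case=> /hA-> /hB->.
- by case=> /hA-> /hB->.
- by case=> /hA-> /hB->.
- by case=> /ty_code_inj e; subst=> /hA->.
- by case=> /ty_code_inj e; subst=> /hA->.
Qed.

Definition decode {X : Type} (c : X -> nat) (k : nat) : option X :=
  match pselect (exists x, c x = k) with
  | left h => Some (projT1 (cid h))
  | right _ => None
  end.

Lemma decodeK (X : Type) (c : X -> nat) : injective c -> pcancel c (decode c).
Proof.
move=> hc x; rewrite /decode; case: pselect => [h|[]]; last by exists x.
by case: (cid h) => y /hc /= ->.
Qed.

Lemma injective_unbounded (f : nat -> nat) (m : nat) : injective f -> exists l, m <= f l.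
Proof.
move=> hf; apply: contrapT => h.
have lt l : f l < m by rewrite ltnNge; apply/negP => hl; apply: h; exists l.
pose g (i : 'I_m.+1) := Ordinal (lt i).
have /leq_card : injective g by move=> i j /(congr1 val)/= /hf; exact: val_inj.
by rewrite !card_ord ltnn.
Qed.

(** * Henkin completeness *)

Section Extend.
Variables (P : nat -> Type) (up : forall n, P n -> P n.+1) (d : forall n, P n) (m : nat).
Variable p : P m.

(** Carries [p] from stage [m] to all later stages along [up]; the values below [m] are junk. Since
    [P] is a dependent family, [p] can only be returned through a cast along [m = n]. *)
Fixpoint extend (n : nat) : P n :=
  match pselect (m = n) with
  | left e => eq_rect m P p n e
  | right _ => match n with 0 => d 0 | S k => up (extend k) end
  end.

End Extend.

Lemma extend_id (P : nat -> Type) up d (m : nat) (p : P m) : extend up d p m = p.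
Proof.
by case: m p => [|k] q /=; case: pselect => // e; rewrite (Prop_irrelevance e erefl).
Qed.

Lemma extend_S (P : nat -> Type) up d (m : nat) (p : P m) (n : nat) :
  m <= n -> extend up d p n.+1 = up n (extend up d p n).
Proof. by move=> h /=; case: pselect => // e; rewrite e ltnn in h. Qed.

(** Every type has a closed term, so a fresh variable can be added to the context without making the
    hypotheses stronger. *)
Fixpoint closed_tm (G : list ty) (s : ty) : tm G s :=
  match s with
  | N => 𝟎
  | Arr s t => tCon (cPi t s) · closed_tm G t
  end.

Section Henkin.
Variables (T : theory) (T_sub : sub_closed T) (A0 : fm []).
Hypothesis A0_unprovable : ~ proves T A0.

(* Stage [n] adds a variable of type [wit_ty n], a prospective witness for an
   existential formula.  The types are fixed in advance so that the contexts do
   not depend on the formulas treated. *)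
Definition wit_ty (n : nat) : ty :=
  match (unpickle n : option (nat * nat * nat)) with
  | Some (i, _, _) => odflt N (decode (pickle \o ty_code) i)
  | None => N
  end.

Fixpoint ctx (n : nat) : list ty :=
  match n with 0 => [] | S k => wit_ty k :: ctx k end.

Definition task := {m : nat & {s : ty & fm (s :: ctx m)}}.

Definition task_code (t : task) : nat :=
  pickle (projT1 t, ty_code (projT1 (projT2 t)), fm_code (projT2 (projT2 t))).

Lemma task_code_inj : injective task_code.
Proof.
move=> [m [s A]] [m' [s' A']] /(pcan_inj pickleK) /= [e].
by subst=> /ty_code_inj e; subst=> /fm_code_inj->.
Qed.

Definition wk1 {s n} (A : fm (s :: ctx n)) : fm (s :: ctx n.+1) :=
  ren_fm (up_ren (fun _ v => VS v)) A.

(** The stage number codes a triple (i, j, l): [i] fixes the type of the new variable, [j] the task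
    to be treated, and the free component [l] makes every task recur at arbitrarily late stages.
    Stages without a suitable task treat [⊥]. *)
Definition wit_fm (n : nat) : fm (wit_ty n :: ctx n) :=
  match (unpickle n : option (nat * nat * nat)) with
  | Some (_, j, _) =>
    match decode task_code j with
    | Some (existT _ m (existT _ s A)) =>
      match pselect (s = wit_ty n) with
      | left e =>
        eq_rect s (fun s => fm (s :: ctx n))
          (extend (P := fun n => fm (s :: ctx n)) (@wk1 s) (fun=> ⊥) A n) _ e
      | right _ => ⊥
      end
    | None => ⊥
    end
  | None => ⊥
  end.

Lemma wit_fmP (m : nat) (s : ty) (B : forall n, fm (s :: ctx n)) :
    (forall n, m <= n -> B n.+1 = wk1 (B n)) ->
  exists n, m <= n /\ exists e : s = wit_ty n,
    wit_fm n = eq_rect s (fun s => fm (s :: ctx n)) (B n) _ e.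
Proof.
move=> hB.
pose i := pickle (ty_code s); pose j := task_code (existT _ m (existT _ s (B m))).
have [l hl] : exists l : nat, m <= pickle (i, j, l).
  apply: (injective_unbounded (f := fun l => pickle (i, j, l))).
  by move=> l l' /(pcan_inj pickleK) [].
set n := pickle _ in hl; exists n; split => //.
have e : s = wit_ty n.
  have hc : injective (pickle \o ty_code) by apply: inj_comp ty_code_inj; exact: pcan_inj pickleK.
  by rewrite /wit_ty /n pickleK /i -[pickle _]/((pickle \o ty_code) s) (decodeK hc).
exists e; rewrite /wit_fm.
have -> : unpickle n = Some (i, j, l) by rewrite /n pickleK.
rewrite /j (decodeK task_code_inj); case: pselect => // e'.
rewrite (Prop_irrelevance e' e).
suff -> : extend (P := fun n => fm (s :: ctx n)) (@wk1 s) (fun=> ⊥) (B m) n = B n by [].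
have idm : extend (P := fun n => fm (s :: ctx n)) (@wk1 s) (fun=> ⊥) (B m) m = B m.
  exact: (extend_id (P := fun n => fm (s :: ctx n))).
elim: (n) hl => [|k IH]; first by rewrite leqn0 => /eqP <-.
- rewrite leq_eqVlt => /orP [/eqP <- //|].
  by rewrite ltnS => h; rewrite (extend_S (P := fun n => fm (s :: ctx n))) // IH // hB.
Qed.

Definition consistent (G : list ty) (H : list (fm G)) := ~ derives T H ⊥.

(** Instead of the implication from the existential formula to its instance, the instance itself is
    assumed whenever the existential formula is consistent with the hypotheses so far. One process
    thereby supplies witnesses and, applied to vacuous quantifiers, also decides every formula. *)
Fixpoint hyps (n : nat) : list (fm (ctx n)) :=
  match n with
  | 0 => [¬ A0]
  | S k =>
    if pselect (consistent ((∃[_] wit_fm k) :: hyps k))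
    then wit_fm k :: map wk_fm (hyps k) else map wk_fm (hyps k)
  end.

Lemma hyps_consistent (n : nat) : consistent (hyps n).
Proof.
elim: n => [|n IH] /= h.
  by apply: A0_unprovable; apply: d_dne; apply: d_impI.
case: pselect h => /= hc h.
- apply hc; apply: (d_exE (A := wit_fm n)); first by apply: d_hyp; left.
  by apply: derives_incl h _ _ => A [->|hA]; [left | right; right].
(* At a stage that adds no hypothesis only the new variable has to be discharged; this is done with
   the trivially true [∃ ¬ ⊥], witnessed by a closed term. *)
- apply: IH; apply: (d_exE (s := wit_ty n) (A := ¬ ⊥)).
    apply: (d_exI (a := closed_tm _ _)); apply: d_impI; apply: d_hyp; by left.
  by apply: derives_incl h _ _ => A hA; right.
Qed.

Lemma hyps_S (n : nat) (A : fm (ctx n)) :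
  derives T (hyps n) A -> derives T (hyps n.+1) (wk_fm A).
Proof.
move=> /(derives_wk (wit_ty n) T_sub) h /=.
by case: pselect => hc //=; apply: derives_incl h _ _ => B hB; right.
Qed.

(** The limit of the stages has no context of its own, so a formula of the limit theory is a family
    with one member in each [ctx n], significant only from some stage on. *)
Definition true_fm (A : forall n, fm (ctx n)) :=
  exists m, forall n, m <= n -> derives T (hyps n) (A n).

Definition coherent_fm (A : forall n, fm (ctx n)) :=
  exists m, forall n, m <= n -> A n.+1 = wk_fm (A n).

Lemma true_fm_from (A : forall n, fm (ctx n)) (m n : nat) :
    (forall n, m <= n -> A n.+1 = wk_fm (A n)) -> m <= n ->
  derives T (hyps n) (A n) -> true_fm A.
Proof.
move=> hA mn h; exists n => k; elim: k => [|k IH]; first by rewrite leqn0 => /eqP <-.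
rewrite leq_eqVlt => /orP [/eqP <- //|]; rewrite ltnS => nk.
by rewrite hA ?(leq_trans mn) //; apply: hyps_S; exact: IH.
Qed.

Lemma true_fm1 (A B : forall n, fm (ctx n)) :
    (forall n, derives T (hyps n) (A n) -> derives T (hyps n) (B n)) ->
  true_fm A -> true_fm B.
Proof. by move=> h [m hm]; exists m => n /hm; exact: h. Qed.

Lemma true_fm2 (A B C : forall n, fm (ctx n)) :
    (forall n, derives T (hyps n) (A n) -> derives T (hyps n) (B n) ->
       derives T (hyps n) (C n)) ->
  true_fm A -> true_fm B -> true_fm C.
Proof.
move=> h [m hm] [m' hm']; exists (maxn m m') => n; rewrite geq_max => /andP [/hm a /hm' b].
exact: h.
Qed.

Lemma true_bot (A : forall n, fm (ctx n)) : (forall n, A n = ⊥) -> ~ true_fm A.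
Proof. by move=> hA [m /(_ m (leqnn _))]; rewrite hA; exact: hyps_consistent. Qed.

Definition coherent_tm (s : ty) (a : forall n, tm (ctx n) s) :=
  exists m, forall n, m <= n -> a n.+1 = wk (a n).

Definition fam (s : ty) := {a : forall n, tm (ctx n) s | coherent_tm a}.

(** Consider a stage that treats [B]. Either the existential formula was consistent there, and the
    variable added at that stage is a witness, or the hypotheses refuted it. *)
Lemma witness (m : nat) (s : ty) (B : forall n, fm (s :: ctx n)) :
    (forall n, m <= n -> B n.+1 = wk1 (B n)) ->
  (exists a : fam s, true_fm (fun n => inst (B n) (sval a n))) \/
  true_fm (fun n => ¬ ∃[s] B n).
Proof.
move=> hB; have [n [mn [e en]]] := wit_fmP hB; subst s; rewrite /= in en.
have [hc|hc] := pselect (consistent ((∃[_] B n) :: hyps n)); [left|right]; last first.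
  apply: (true_fm_from (m := m) (n := n)) => //; first by move=> k mk; rewrite hB.
  by apply: d_impI; apply: contrapT.
pose a : forall k, tm (ctx k) (wit_ty n) :=
  extend (P := fun k => tm (ctx k) (wit_ty n)) (fun k b => wk b) (fun k => closed_tm _ _)
    (m := n.+1) #0.
have aS k : n < k -> a k.+1 = wk (a k).
  exact: (extend_S (P := fun k => tm (ctx k) (wit_ty n))).
have ha : coherent_tm a by exists n.+1.
exists (exist _ a ha) => /=.
apply: (true_fm_from (m := n.+1) (n := n.+1)) => //.
  move=> k nk; rewrite aS // hB ?(leq_trans mn) 1?ltnW //.
  rewrite /inst /wk1 wk_fmE ren_fmE !sub_fm_comp; congr sub_fm.
  by apply: sub_ext => //=; rewrite wkE.
have -> : a n.+1 = #0 by exact: (extend_id (P := fun k => tm (ctx k) (wit_ty n))).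
rewrite hB // inst_up_ren; apply: d_hyp.
by rewrite /= en; case: pselect => // h; left.
Qed.

(** Completeness of the limit theory needs no separate extension step: [witness] is applied to the
    vacuous quantification [∃[N] A], whose truth amounts to that of [A]. *)
Lemma true_or_not (A : forall n, fm (ctx n)) :
  coherent_fm A -> true_fm A \/ true_fm (fun n => ¬ A n).
Proof.
move=> [m hA].
have hB n : m <= n -> wk_fm (t := N) (A n.+1) = wk1 (wk_fm (A n)).
  move=> mn; rewrite hA // /wk1 !wk_fmE ren_fmE !sub_fm_comp; congr sub_fm.
case: (witness hB) => [[a h]|h]; [left|right].
  by apply: true_fm1 h => n; rewrite inst_wk_fm.
apply: true_fm1 h => n h; apply: d_impI.
apply: (d_impE (A := ∃[N] wk_fm (A n))); first by apply: derives_incl h _ _ => B hb; right.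
by apply: (d_exI (a := 𝟎)); rewrite inst_wk_fm; apply: d_hyp; left.
Qed.

Lemma fam_app_coherent (s t : ty) (a : fam (s ⇒ t)) (b : fam s) :
  coherent_tm (fun n => sval a n · sval b n).
Proof.
case: a b => a [m ha] [b [m' hb]]; exists (maxn m m') => n /=.
by rewrite geq_max => /andP [/ha-> /hb->].
Qed.

Lemma fam_con_coherent (s : ty) (c : const s) : coherent_tm (fun n => tCon c).
Proof. by exists 0. Qed.

Definition henkin : structure := @Structure fam
  (fun s t a b => exist _ _ (fam_app_coherent a b))
  (fun s c => exist _ _ (fam_con_coherent c))
  (fun a b => true_fm (fun n => sval a n ≐ sval b n))
  (fun a b => true_fm (fun n => sval a n ≺ sval b n)).

Definition env_sub (G : list ty) (r : env henkin G) (n : nat) : substitution G (ctx n) :=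
  fun s v => sval (r s v) n.

Lemma eval_henkin (G : list ty) (r : env henkin G) (s : ty) (a : tm G s) (n : nat) :
  sval (eval r a) n = sub_tm (@env_sub G r n) a.
Proof. by elim: a => //= s' t b -> c ->. Qed.

Lemma env_coherent (G : list ty) (r : env henkin G) :
  exists m, forall n, m <= n -> forall s (v : var G s), env_sub r n.+1 v = wk (env_sub r n v).
Proof.
elim: G r => [|t G IH] r; first by exists 0 => n _ s v; case: (var_nil v).
have [m hm] := IH (fun s v => r s (VS v)); have [m' hm'] := proj2_sig (r t VZ).
exists (maxn m m') => n; rewrite geq_max => /andP [mn mn'].
by apply: var_case => [|s v]; [exact: hm' | exact: hm].
Qed.

Lemma sub_coherent (G : list ty) (r : env henkin G) (A : fm G) :
  coherent_fm (fun n => sub_fm (@env_sub G r n) A).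
Proof.
have [m hm] := env_coherent r; exists m => n mn.
rewrite wk_fmE sub_fm_comp; congr sub_fm.
do 2 apply: functional_extensionality_dep => ?.
by rewrite hm // wkE.
Qed.

Lemma env_sub_econs (G : list ty) (t : ty) (r : env henkin G) (a : fam t) (n : nat) :
  @env_sub _ (econs (M := henkin) a r) n = scons (sval a n) (@env_sub G r n).
Proof. exact: sub_ext. Qed.

Lemma inst_up_sub (G D : list ty) (t : ty) (f : substitution G D) (A : fm (t :: G))
    (a : tm D t) :
  inst (sub_fm (up_sub f) A) a = sub_fm (scons a f) A.
Proof.
rewrite /inst sub_fm_comp; congr sub_fm.
by apply: sub_ext => //= s v; rewrite sub_tm_scons sub_tm_id.
Qed.

Lemma true_not (A : forall n, fm (ctx n)) : true_fm A -> ~ true_fm (fun n => ¬ A n).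
Proof.
move=> h h'; apply: (true_bot (A := fun=> ⊥)) => //.
by apply: true_fm2 h' h => n; exact: d_impE.
Qed.

Lemma henkin_ex (G : list ty) (s : ty) (A : fm (s :: G)) (r : env henkin G) :
    true_fm (fun n => ∃[s] sub_fm (up_sub (@env_sub G r n)) A) ->
  exists a : fam s, true_fm (fun n => sub_fm (@env_sub _ (econs (M := henkin) a r) n) A).
Proof.
move=> h; have [m hm] := env_coherent r.
have hB n : m <= n -> sub_fm (up_sub (@env_sub G r n.+1)) A
    = wk1 (sub_fm (up_sub (@env_sub G r n)) A).
  move=> mn; rewrite /wk1 ren_fmE sub_fm_comp; congr sub_fm.
  by apply: sub_ext => //= s' v; rewrite hm // !wkE !sub_tm_comp.
case: (witness hB) => [[a ha]|/(true_not h) //].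
by exists a; apply: true_fm1 ha => n; rewrite inst_up_sub env_sub_econs.
Qed.

(** The truth lemma. Implication, disjunction and the universal quantifier rely on [true_or_not];
    both quantifiers take their witnesses or counterexamples from [henkin_ex]. *)
Lemma henkin_sat (G : list ty) (A : fm G) (r : env henkin G) :
  sat r A <-> true_fm (fun n => sub_fm (@env_sub G r n) A).
Proof.
elim: A r => {G} /=.
- move=> G a b r; split; apply: true_fm1 => n; by rewrite !eval_henkin.
- move=> G a b r; split; apply: true_fm1 => n; by rewrite !eval_henkin.
- by move=> G r; split => // /true_bot; apply.
- move=> G A hA B hB r; rewrite hA hB; split => [h|].
    case: (true_or_not (sub_coherent r A)) => hc.
      apply: true_fm1 (h hc) => n hn; apply: d_impI.
      by apply: derives_incl hn _ _ => C hC; right.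
    apply: true_fm1 hc => n hn; apply: d_impI; apply: d_dne; apply: d_impI.
    apply: (d_impE (A := sub_fm (@env_sub G r n) A)); last by apply: d_hyp; right; left.
    by apply: derives_incl hn _ _ => C hC; right; right.
  by move=> h h'; apply: true_fm2 h h' => n; exact: d_impE.
- move=> G A hA B hB r; rewrite hA hB; split => [[h h']|h].
    by apply: true_fm2 h h' => n; exact: d_andI.
  by split; apply: true_fm1 h => n; [exact: d_andE1 | exact: d_andE2].
- move=> G A hA B hB r; rewrite hA hB; split => [[] h|h].
  + by apply: true_fm1 h => n; exact: d_orI1.
  + by apply: true_fm1 h => n; exact: d_orI2.
  case: (true_or_not (sub_coherent r A)) => hc; first by left.
  right; apply: true_fm2 h hc => n h hc.
  apply: (d_orE h); last by apply: d_hyp; left.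
  apply: d_dne; apply: d_impI.
  apply: (d_impE (A := sub_fm (@env_sub G r n) A)); last by apply: d_hyp; right; left.
  by apply: derives_incl hc _ _ => C hC; right; right.
- move=> G s A hA r; split => [h|h a]; last first.
    apply/hA; apply: true_fm1 h => n h.
    by rewrite env_sub_econs -inst_up_sub; exact: d_allE.
  case: (true_or_not (sub_coherent r (∀[s] A))) => // hc.
  (* Classically, the negated universal formula yields an existential one, whose witness is the
     counterexample. *)
  have : true_fm (fun n => ∃[s] sub_fm (up_sub (@env_sub G r n)) (¬ A)).
    apply: true_fm1 hc => n hc; apply: d_dne; apply: d_impI.
    apply: (d_impE (A := ∀[s] sub_fm (up_sub (@env_sub G r n)) A)).
      by apply: derives_incl hc _ _ => C hC; right.
    apply: d_allI; apply: d_dne; apply: d_impI.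
    apply: (d_impE (A := wk_fm (∃[s] sub_fm (up_sub (@env_sub G r n)) (¬ A)))).
      by apply: d_hyp; right; left.
    apply: (d_exI (A := ren_fm (up_ren (fun _ v => VS v))
      (sub_fm (up_sub (@env_sub G r n)) (¬ A))) (a := #0)).
    by rewrite inst_up_ren; apply: d_hyp; left.
  by case/henkin_ex => a /= ha; have /hA/true_not := h a.
- move=> G s A hA r; split => [[a /hA h]|/henkin_ex [a /hA h]]; last by exists a.
  apply: true_fm1 h => n; rewrite env_sub_econs -inst_up_sub => h.
  exact: d_exI h.
Qed.

Lemma henkin_models : models henkin T.
Proof.
move=> G A r hA; apply/henkin_sat; exists 0 => n _; apply: d_axiom; exact: T_sub.
Qed.

Lemma henkin_refutes : ~ sat (M := henkin) enil A0.
Proof.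
have : sat (M := henkin) enil (¬ A0); last by [].
apply/(henkin_sat (¬ A0)).
apply: (true_fm_from (A := fun n => sub_fm (@env_sub _ enil n) (¬ A0)) (m := 0) (n := 0)) => [n _||].
- rewrite wk_fmE sub_fm_comp; congr sub_fm; exact: sub_nil_ext.
- by [].
- rewrite (sub_nil_ext (@env_sub _ _ 0) (fun s (v : var [] s) => tVar (G := ctx 0) v)).
  by rewrite (sub_fm_id (¬ A0)); apply: d_hyp; left.
Qed.

End Henkin.

Lemma completeness (T : theory) (A : fm []) :
    sub_closed T -> (forall M : structure, models M T -> sat (M := M) enil A) ->
  proves T A.
Proof.
move=> hT h; apply: contrapT => hA.
by apply: (henkin_refutes hT hA); apply: h; exact: henkin_models.
Qed.

(** * Extensional models *)

Section Quotient.
Variables (X : Type) (R : X -> X -> Prop).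
Hypotheses (R_refl : forall x, R x x) (R_sym : forall x y, R x y -> R y x)
  (R_trans : forall x y z, R x y -> R y z -> R x z).

(** Classes are predicates: extensionality makes classes of related elements equal, and choice
    provides representatives. *)
Definition quot := {P : X -> Prop | exists x, P = R x}.
Definition cls (x : X) : quot := exist _ (R x) (ex_intro _ x erefl).
Definition repr (q : quot) : X := projT1 (cid (proj2_sig q)).

Lemma cls_repr (q : quot) : cls (repr q) = q.
Proof.
case: q => P hP; apply: eq_exist => /=.
by rewrite /repr /=; case: (cid hP) => x /= ->.
Qed.

Lemma cls_eq (x y : X) : cls x = cls y <-> R x y.
Proof.
split => [[e]|h]; first by rewrite e; exact: R_refl.
apply: eq_exist; apply/funext => z; apply/propext; split; last exact: R_trans.
exact: R_trans (R_sym h).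
Qed.

End Quotient.

(** The last two fields turn the hereditarily pointwise equality [eqT] into equality of the
    metatheory, so that the equations for combinators and recursor can be used for rewriting. *)
Record model := Model {
  str :> structure;
  models_RCA0w : models str RCA0w;
  eq0_eq : forall x y : dom str N, eq0 x y <-> x = y;
  dom_ext : forall s t (x y : dom str (s ⇒ t)), (forall z, app x z = app y z) -> x = y }.

Fixpoint eq_dom (M : structure) (s : ty) : dom M s -> dom M s -> Prop :=
  match s with
  | N => fun x y => eq0 x y
  | Arr s t => fun x y => forall z, eq_dom (app x z) (app y z)
  end.

Lemma sat_eqT (M : structure) (s : ty) (G : list ty) (r : env M G) (a b : tm G s) :
  sat r (eqT a b) <-> eq_dom (eval r a) (eval r b).
Proof.
elim: s G r a b => //= s _ t IH G r a b.
by split=> h x; have := h x; rewrite IH /= !eval_wk.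
Qed.

Section ExtensionalQuotient.
Variables (M : structure) (hM : models M RCA0w).

Let env1 s (x : dom M s) : env M [s] := econs x enil.
Let env2 s t (x : dom M s) (y : dom M t) : env M [s; t] := econs x (env1 y).

Lemma eq_dom_refl (s : ty) (x : dom M s) : eq_dom x x.
Proof.
elim: s x => [x|s _ t IH x z] /=; last exact: IH.
exact: hM (env1 x) (ax_eq_refl #0).
Qed.

Lemma eq_dom_sym (s : ty) (x y : dom M s) : eq_dom x y -> eq_dom y x.
Proof.
elim: s x y => [x y|s _ t IH x y h z] /=; last exact: IH.
exact: hM (env2 x y) (ax_eq_sym #0 #1).
Qed.

Lemma eq_dom_trans (s : ty) (x y z : dom M s) : eq_dom x y -> eq_dom y z -> eq_dom x z.
Proof.
elim: s x y z => [x y z|s _ t IH x y z h h' u] /=; last exact: IH (h u) (h' u).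
exact: hM (econs x (env2 y z)) (ax_eq_trans #0 #1 #2).
Qed.

(** Congruence in the function is the definition of [eq_dom]; congruence in the argument is exactly
    the extensionality axiom. This is what lets application descend to the quotient. *)
Lemma eq_dom_app (s t : ty) (f g : dom M (s ⇒ t)) (x y : dom M s) :
  eq_dom f g -> eq_dom x y -> eq_dom (app f x) (app g y).
Proof.
move=> hf hx; apply: (eq_dom_trans (y := app f y)); last exact: hf.
have := hM (econs x (env2 y f)) (ax_ext #0 #1 #2).
by rewrite /= !sat_eqT; exact.
Qed.

Lemma lt0_eq (x x' y y' : dom M N) : eq0 x x' -> eq0 y y' -> lt0 x y -> lt0 x' y'.
Proof. exact: hM (econs x (econs x' (env2 y y'))) (ax_eq_lt #0 #1 #2 #3). Qed.

Definition ext_quot : structure := @Structure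
  (fun s => quot (@eq_dom M s))
  (fun s t f x => cls _ (app (repr f) (repr x)))
  (fun s c => cls _ (con c))
  (fun x y => x = y)
  (fun x y => lt0 (repr x) (repr y)).

Let q (s : ty) (x : dom M s) : dom ext_quot s := cls (@eq_dom M s) x.

Lemma q_eq (s : ty) (x y : dom M s) : q x = q y <-> eq_dom x y.
Proof.
apply: cls_eq; [exact: eq_dom_refl | exact: eq_dom_sym | exact: eq_dom_trans].
Qed.

Lemma repr_q (s : ty) (x : dom M s) : eq_dom (repr (q x)) x.
Proof. apply/q_eq; exact: cls_repr. Qed.

Lemma q_app (s t : ty) (f : dom M (s ⇒ t)) (x : dom M s) :
  app (q f) (q x) = q (app f x).
Proof. by apply/q_eq; apply: eq_dom_app; exact: repr_q. Qed.

Lemma eval_ext_quot (G : list ty) (r : env M G) (s : ty) (a : tm G s) :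
  eval (M := ext_quot) (fun s v => q (r s v)) a = q (eval r a).
Proof. by elim: a => //= s' t b -> c ->; exact: q_app. Qed.

Lemma sat_ext_quot (G : list ty) (A : fm G) (r : env M G) :
  sat (M := ext_quot) (fun s v => q (r s v)) A <-> sat r A.
Proof.
have qecons G' t (x : dom M t) (r' : env M G') :
    econs (M := ext_quot) (q x) (fun s v => q (r' s v)) = fun s v => q (econs x r' v).
  exact: env_ext.
have surj t (x : dom ext_quot t) : x = q (repr x) by rewrite /q cls_repr.
elim: A r => //= {G}.
- by move=> G a b r; rewrite !eval_ext_quot q_eq.
- move=> G a b r; rewrite !eval_ext_quot.
  by split; apply: lt0_eq; (try exact: repr_q); apply: eq_dom_sym; exact: repr_q.
- by move=> G A hA B hB r; rewrite hA hB.
- by move=> G A hA B hB r; rewrite hA hB.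
- by move=> G A hA B hB r; rewrite hA hB.
- move=> G s A hA r; split=> h x; first by rewrite -hA -qecons.
  by rewrite (surj _ x) qecons hA.
- move=> G s A hA r; split=> -[x h]; last by exists (q x); rewrite qecons hA.
  by exists (repr x); rewrite -hA -qecons -surj.
Qed.

Lemma ext_quot_models : models ext_quot RCA0w.
Proof.
move=> G A r hA.
have -> : r = fun s v => q (repr (r s v)).
  by do 2 apply: functional_extensionality_dep => ?; rewrite /q cls_repr.
by apply/sat_ext_quot; exact: hM.
Qed.

Lemma ext_quot_ext (s t : ty) (x y : dom ext_quot (s ⇒ t)) :
  (forall z, app x z = app y z) -> x = y.
Proof.
move=> h; rewrite -(cls_repr x) -(cls_repr y); apply/q_eq => z.
apply/q_eq; rewrite -!q_app /q !cls_repr; exact: h.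
Qed.

Definition ext_model : model :=
  @Model ext_quot ext_quot_models (fun x y => iff_refl _) ext_quot_ext.

End ExtensionalQuotient.

Lemma RCA0w_complete (A : fm []) :
  (forall M : model, sat (M := M) enil A) -> proves RCA0w A.
Proof.
move=> h; apply: (completeness RCA0w_sub_closed) => M hM.
apply/(sat_ext_quot hM); have := h (ext_model hM).
by congr sat; exact: env_nil_ext.
Qed.

(** * The ordered field of fractions of an ordered semiring with subtraction *)

Import Order.TTheory GRing.Theory Num.Theory.
Local Open Scope ring_scope.

(** The field [olt_sub] brings a fraction (a - b) / c with b < a to the form d / c with d positive,
    from which inverses and the positivity of products are obtained. *)
Record osemiring := OSemiring {
  osort :> comNzSemiRingType;
  olt : osort -> osort -> Prop;
  olt_irrefl : forall a, ~ olt a a;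
  olt_trans : forall a b c, olt a b -> olt b c -> olt a c;
  olt_total : forall a b, olt a b \/ a = b \/ olt b a;
  olt_add : forall a b c, olt a b -> olt (a + c) (b + c);
  olt_mul : forall a b c, olt 0 c -> olt a b -> olt (a * c) (b * c);
  olt_01 : olt 0 1;
  olt_sub : forall a b, olt a b -> exists d, b = a + d }.

Arguments olt {_} _ _.

Section Fractions.
Variable S : osemiring.

Lemma olt_addl (a b c : S) : olt a b -> olt (c + a) (c + b).
Proof. by rewrite ![c + _]addrC; exact: olt_add. Qed.

Lemma osr_addI (a b c : S) : a + c = b + c -> a = b.
Proof.
move=> e; case: (olt_total a b) => [|[]] // /(olt_add c).
- by rewrite e => /olt_irrefl.
- by rewrite e => /olt_irrefl.
Qed.

Lemma osr_mulI (a b c : S) : olt 0 c -> a * c = b * c -> a = b.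
Proof.
move=> hc e; case: (olt_total a b) => [|[]] // /(olt_mul hc).
- by rewrite e => /olt_irrefl.
- by rewrite e => /olt_irrefl.
Qed.

Lemma osr_addlt (a b c : S) : olt (a + c) (b + c) -> olt a b.
Proof.
move=> h; case: (olt_total a b) => [|[e|/(olt_add c) h']] //.
- by case: (olt_irrefl (a := a + c)); rewrite {2}e.
- by case: (olt_irrefl (olt_trans h h')).
Qed.

Lemma osr_mullt (a b c : S) : olt 0 c -> olt (a * c) (b * c) -> olt a b.
Proof.
move=> hc h; case: (olt_total a b) => [|[e|/(olt_mul hc) h']] //.
- by case: (olt_irrefl (a := a * c)); rewrite {2}e.
- by case: (olt_irrefl (olt_trans h h')).
Qed.

Lemma osr_mul_gt0 (a b : S) : olt 0 a -> olt 0 b -> olt 0 (a * b).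
Proof. by move=> ha hb; rewrite -[0](mul0r b); exact: olt_mul. Qed.

Lemma osr_ltD (a d : S) : olt a (a + d) <-> olt 0 d.
Proof.
split => [h|/(olt_add a)]; last by rewrite add0r addrC.
by apply: (osr_addlt (c := a)); rewrite add0r addrC.
Qed.

(* [Frac a b c] stands for [(a - b) / c]. *)
Record frac := Frac { fpos : S; fneg : S; fden : S; fden_gt0 : olt 0 fden }.

Definition feq (x y : frac) : Prop :=
  fpos x * fden y + fneg y * fden x = fpos y * fden x + fneg x * fden y.

Definition flt (x y : frac) : Prop :=
  olt (fpos x * fden y + fneg y * fden x) (fpos y * fden x + fneg x * fden y).

Lemma feq_refl x : feq x x.
Proof. by []. Qed.

Lemma feq_sym x y : feq x y -> feq y x.
Proof. by rewrite /feq => ->. Qed.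

(** In the absence of subtraction the middle fraction is eliminated by multiplying with its
    denominator and adding its cross terms on both sides; the order makes both operations
    cancellable. *)
Lemma feq_trans x y z : feq x y -> feq y z -> feq x z.
Proof.
case: x y z => [a b c hc] [a1 b1 c1 hc1] [a2 b2 c2 hc2]; rewrite /feq /= => h h'.
apply: (osr_mulI hc1); apply: (osr_addI (c := a1 * c * c2 + b1 * c * c2)).
have -> : (a * c2 + b2 * c) * c1 + (a1 * c * c2 + b1 * c * c2) =
  (a * c1 + b1 * c) * c2 + (a1 * c2 + b2 * c1) * c by ring.
rewrite h h'; ring.
Qed.

Definition fadd (x y : frac) : frac :=
  Frac (fpos x * fden y + fpos y * fden x) (fneg x * fden y + fneg y * fden x)
    (osr_mul_gt0 (fden_gt0 x) (fden_gt0 y)).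

Definition fopp (x : frac) : frac := Frac (fneg x) (fpos x) (fden_gt0 x).

Definition fmul (x y : frac) : frac :=
  Frac (fpos x * fpos y + fneg x * fneg y) (fpos x * fneg y + fneg x * fpos y)
    (osr_mul_gt0 (fden_gt0 x) (fden_gt0 y)).

Definition finj (a : S) : frac := Frac a 0 (@olt_01 S).

Lemma fadd_eq x x' y y' : feq x x' -> feq y y' -> feq (fadd x y) (fadd x' y').
Proof.
case: x x' y y' => [a b c hc] [a1 b1 c1 hc1] [a2 b2 c2 hc2] [a3 b3 c3 hc3].
rewrite /feq /= => h h'.
transitivity (c2 * c3 * (a * c1 + b1 * c) + c * c1 * (a2 * c3 + b3 * c2)); first by ring.
rewrite h h'; ring.
Qed.

Lemma fopp_eq x x' : feq x x' -> feq (fopp x) (fopp x').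
Proof.
case: x x' => [a b c hc] [a1 b1 c1 hc1]; rewrite /feq /= => h.
by rewrite [LHS]addrC -h addrC.
Qed.

Lemma fmulC x y : feq (fmul x y) (fmul y x).
Proof. rewrite /feq /=; ring. Qed.

Lemma fmul_eql x x' y : feq x x' -> feq (fmul x y) (fmul x' y).
Proof.
case: x x' y => [a b c hc] [a1 b1 c1 hc1] [a2 b2 c2 hc2]; rewrite /feq /= => h.
transitivity (c2 * a2 * (a * c1 + b1 * c) + c2 * b2 * (a1 * c + b * c1)); first by ring.
rewrite h -{2}h; ring.
Qed.

Lemma fmul_eq x x' y y' : feq x x' -> feq y y' -> feq (fmul x y) (fmul x' y').
Proof.
move=> h h'; apply: feq_trans (fmul_eql y h) _.
apply: feq_trans (fmulC _ _) _; apply: feq_trans (fmul_eql _ h') (fmulC _ _).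
Qed.

Lemma flt_eq x x' y y' : feq x x' -> feq y y' -> flt x y -> flt x' y'.
Proof.
case: x x' y y' => [a b c hc] [a1 b1 c1 hc1] [a2 b2 c2 hc2] [a3 b3 c3 hc3].
rewrite /feq /flt /= => h h' hl.
apply: (osr_mullt (osr_mul_gt0 hc hc2)).
apply: (osr_addlt (c := b * c1 * c2 * c3 + a2 * c3 * c * c1)).
have := olt_add (b1 * c * c2 * c3 + a3 * c2 * c * c1) (olt_mul (osr_mul_gt0 hc1 hc3) hl).
congr olt; last by ring.
transitivity ((a * c1 + b1 * c) * c2 * c3 + (a3 * c2 + b2 * c3) * c * c1); first by ring.
by rewrite h -h'; ring.
Qed.

Definition fracs := quot feq.
HB.instance Definition _ := gen_eqMixin fracs.
HB.instance Definition _ := gen_choiceMixin fracs.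

Let fcls : frac -> fracs := cls feq.

Lemma fcls_eq x y : fcls x = fcls y <-> feq x y.
Proof. by apply: cls_eq; [exact: feq_refl | exact: feq_sym | exact: feq_trans]. Qed.

Lemma fcls_ind (P : fracs -> Prop) : (forall x, P (fcls x)) -> forall q, P q.
Proof. by move=> h q; rewrite -(cls_repr q); exact: h. Qed.

Lemma repr_fcls x : feq (repr (fcls x)) x.
Proof. by apply/fcls_eq; rewrite /fcls cls_repr. Qed.

Definition qadd (p q : fracs) : fracs := fcls (fadd (repr p) (repr q)).
Definition qopp (p : fracs) : fracs := fcls (fopp (repr p)).
Definition qmul (p q : fracs) : fracs := fcls (fmul (repr p) (repr q)).
Definition qinj (a : S) : fracs := fcls (finj a).
Definition qlt (p q : fracs) : bool := `[< flt (repr p) (repr q) >].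

Lemma qaddE x y : qadd (fcls x) (fcls y) = fcls (fadd x y).
Proof. by apply/fcls_eq; apply: fadd_eq; exact: repr_fcls. Qed.

Lemma qoppE x : qopp (fcls x) = fcls (fopp x).
Proof. by apply/fcls_eq; apply: fopp_eq; exact: repr_fcls. Qed.

Lemma qmulE x y : qmul (fcls x) (fcls y) = fcls (fmul x y).
Proof. by apply/fcls_eq; apply: fmul_eq; exact: repr_fcls. Qed.

Lemma qltE x y : qlt (fcls x) (fcls y) <-> flt x y.
Proof.
split => [/asboolP|h]; first by apply: flt_eq; exact: repr_fcls.
by apply/asboolP; move: h; apply: flt_eq; apply: feq_sym; exact: repr_fcls.
Qed.

Lemma qaddA : associative qadd.
Proof.
elim/fcls_ind=> x; elim/fcls_ind=> y; elim/fcls_ind=> z; rewrite !qaddE.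
by apply/fcls_eq; rewrite /feq /=; ring.
Qed.

Lemma qaddC : commutative qadd.
Proof.
elim/fcls_ind=> x; elim/fcls_ind=> y; rewrite !qaddE.
by apply/fcls_eq; rewrite /feq /=; ring.
Qed.

Lemma qadd0 : left_id (qinj 0) qadd.
Proof.
by elim/fcls_ind=> x; rewrite !qaddE; apply/fcls_eq; rewrite /feq /=; ring.
Qed.

Lemma qaddN : left_inverse (qinj 0) qopp qadd.
Proof.
by elim/fcls_ind=> x; rewrite qoppE !qaddE; apply/fcls_eq; rewrite /feq /=; ring.
Qed.

HB.instance Definition _ := GRing.isZmodule.Build fracs qaddA qaddC qadd0 qaddN.

Lemma qmulA : associative qmul.
Proof.
elim/fcls_ind=> x; elim/fcls_ind=> y; elim/fcls_ind=> z; rewrite !qmulE.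
by apply/fcls_eq; rewrite /feq /=; ring.
Qed.

Lemma qmulC : commutative qmul.
Proof.
by elim/fcls_ind=> x; elim/fcls_ind=> y; rewrite !qmulE; apply/fcls_eq; exact: fmulC.
Qed.

Lemma qmul1 : left_id (qinj 1) qmul.
Proof.
by elim/fcls_ind=> x; rewrite !qmulE; apply/fcls_eq; rewrite /feq /=; ring.
Qed.

Lemma qmulDl : left_distributive qmul qadd.
Proof.
elim/fcls_ind=> x; elim/fcls_ind=> y; elim/fcls_ind=> z; rewrite !(qmulE, qaddE).
by apply/fcls_eq; rewrite /feq /=; ring.
Qed.

Lemma qone_neq0 : qinj 1 != qinj 0.
Proof.
apply/eqP => /fcls_eq; rewrite /feq /= !mulr1 !addr0 => e.
by apply: (olt_irrefl (a := 0 : S)); rewrite -{2}e; exact: olt_01.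
Qed.

HB.instance Definition _ :=
  GRing.Zmodule_isComNzRing.Build fracs qmulA qmulC qmul1 qmulDl qone_neq0.

Lemma qinv_ex (p : fracs) : exists q : fracs, if p == 0 then q = 0 else q * p = 1.
Proof.
case: eqP => [_|]; first by exists 0.
elim/fcls_ind: p => -[a b c hc] hp.
case: (olt_total a b) => [h|[e|h]].
- have [d e] := olt_sub h; subst b; have hd := proj1 (osr_ltD _ _) h.
  by exists (fcls (Frac 0 c hd)); rewrite [_ * _]qmulE; apply/fcls_eq; rewrite /feq /=; ring.
- by case: hp; apply/fcls_eq; rewrite /feq /= e; ring.
- have [d e] := olt_sub h; subst a; have hd := proj1 (osr_ltD _ _) h.
  by exists (fcls (Frac c 0 hd)); rewrite [_ * _]qmulE; apply/fcls_eq; rewrite /feq /=; ring.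
Qed.

Definition qinv (p : fracs) : fracs := projT1 (cid (qinv_ex p)).

Lemma qmulV (p : fracs) : p != 0 -> qinv p * p = 1.
Proof. by rewrite /qinv; case: (cid _) => q /=; case: eqP. Qed.

Lemma qinv0 : qinv 0 = 0.
Proof. by rewrite /qinv; case: (cid _) => q /=; rewrite eqxx. Qed.

HB.instance Definition _ := GRing.ComNzRing_isField.Build fracs qmulV qinv0.

Lemma qlt_add (p q : fracs) : qlt 0 p -> qlt 0 q -> qlt 0 (p + q).
Proof.
elim/fcls_ind: p => x; elim/fcls_ind: q => y /qltE hx /qltE hy.
rewrite [_ + _]qaddE; apply/qltE; move: hx hy; rewrite /flt /= !mulr1 !mul0r !add0r !addr0.
move=> /(olt_mul (fden_gt0 y)) hx /(olt_mul (fden_gt0 x)) hy.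
exact: olt_trans (olt_add _ hx) (olt_addl _ hy).
Qed.

Lemma qlt_mul (p q : fracs) : qlt 0 p -> qlt 0 q -> qlt 0 (p * q).
Proof.
elim/fcls_ind: p => x; elim/fcls_ind: q => y /qltE hx /qltE hy.
rewrite [_ * _]qmulE; apply/qltE; move: hx hy; rewrite /flt /= !mulr1 !mul0r !add0r !addr0.
case: x y => [a b c hc] [a1 b1 c1 hc1] /= h h1.
have [d e] := olt_sub h; have [d1 e1] := olt_sub h1; subst a a1.
have -> : (b + d) * (b1 + d1) + b * b1 = (b + d) * b1 + b * (b1 + d1) + d * d1 by ring.
apply/osr_ltD; exact: osr_mul_gt0 (proj1 (osr_ltD _ _) h) (proj1 (osr_ltD _ _) h1).
Qed.

Lemma qlt_asym (p : fracs) : qlt 0 p -> ~~ qlt p 0.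
Proof.
elim/fcls_ind: p => x /qltE h; apply/negP => /qltE h'.
exact: olt_irrefl (olt_trans h h').
Qed.

Lemma qlt_sub (p q : fracs) : qlt 0 (q - p) = qlt p q.
Proof.
elim/fcls_ind: p => x; elim/fcls_ind: q => y; rewrite [- _]qoppE [_ + _]qaddE.
have e : flt (finj 0) (fadd y (fopp x)) <-> flt x y.
  by rewrite /flt /= !mulr1 !mul0r !add0r !addr0 [fneg y * _ + _]addrC.
by apply/idP/idP => /qltE h; apply/qltE; apply/e.
Qed.

Lemma qlt_total (p : fracs) : p != 0 -> qlt 0 p || qlt p 0.
Proof.
elim/fcls_ind: p => x /eqP hx; apply/orP.
case: (olt_total (fpos (finj 0) * fden x + fneg x * fden (finj 0))
  (fpos x * fden (finj 0) + fneg (finj 0) * fden x)) => [h|[h|h]].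
- by left; apply/qltE.
- by case: hx; apply/fcls_eq; apply: feq_sym.
- by right; apply/qltE.
Qed.

Definition qle (p q : fracs) : bool := (p == q) || qlt p q.
Definition qnorm (p : fracs) : fracs := if qlt p 0 then - p else p.

Lemma qnormN (p : fracs) : qnorm (- p) = qnorm p.
Proof.
rewrite /qnorm; have -> : qlt (- p) 0 = qlt 0 p by rewrite -qlt_sub sub0r opprK.
case: (eqVneq p 0) => [->|]; first by rewrite !oppr0 !if_same.
case/qlt_total/orP => h; first by rewrite h (negbTE (qlt_asym h)) opprK.
by rewrite h; case: ifP => // /qlt_asym; rewrite h.
Qed.

Lemma qge0_norm (p : fracs) : qle 0 p -> qnorm p = p.
Proof.
rewrite /qle /qnorm => /orP [/eqP <-|/qlt_asym /negbTE -> //].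
by rewrite oppr0 if_same.
Qed.

HB.instance Definition _ := Num.IntegralDomain_isLtReal.Build fracs
  qlt_add qlt_mul qlt_asym qlt_sub qlt_total qnormN qge0_norm (fun _ _ => erefl).

Definition frac_field : realFieldType := fracs.

Definition fval (a : S) : frac_field := qinj a.

Lemma fvalD (a b : S) : fval (a + b) = fval a + fval b.
Proof. by rewrite [RHS]qaddE; apply/fcls_eq; rewrite /feq /=; ring. Qed.

Lemma fvalM (a b : S) : fval (a * b) = fval a * fval b.
Proof. by rewrite [RHS]qmulE; apply/fcls_eq; rewrite /feq /=; ring. Qed.

Lemma fval0 : fval 0 = 0.
Proof. by []. Qed.

Lemma fval1 : fval 1 = 1.
Proof. by []. Qed.

Lemma fval_lt (a b : S) : fval a < fval b <-> olt a b.
Proof. by rewrite -[_ < _]/(qlt _ _) qltE /flt /= !mulr1 !addr0. Qed.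

Lemma fval_inj : injective fval.
Proof. by move=> a b /fcls_eq; rewrite /feq /= !mulr1 !addr0. Qed.

Lemma frac_fieldP (p : frac_field) :
  exists a b c : S, olt 0 c /\ p = (fval a - fval b) / fval c.
Proof.
elim/fcls_ind: p => -[a b c hc]; exists a, b, c; split => //.
have hc0 : fval c != 0 by rewrite gt_eqF // -fval0; apply/fval_lt.
apply: (mulIf hc0); rewrite divfK // [_ * _]qmulE [- _]qoppE [_ + _]qaddE.
by apply/fcls_eq; rewrite /feq /=; ring.
Qed.

End Fractions.

(** * Arithmetic in a model *)

Lemma eq_dom_eq (M : model) (s : ty) (x y : dom M s) : eq_dom x y <-> x = y.
Proof.
elim: s x y => [x y|s _ t IH x y] /=; first exact: eq0_eq.
by split=> [h|-> z]; [apply: dom_ext => z; apply/IH | apply/IH].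
Qed.

Definition num (M : model) : Type := dom M N.

Section NumSemiring.
Variable M : model.
Implicit Types a b c x y : num M.

Definition num0 : num M := con cZero.
Definition num1 : num M := con cOne.
Definition addm x y : num M := app (app (con cPlus) x) y.
Definition mulm x y : num M := app (app (con cTimes) x) y.

Let env1 x : env M [N] := econs x enil.
Let env2 x y : env M [N; N] := econs x (env1 y).
Let env3 x y z : env M [N; N; N] := econs x (env2 y z).

Lemma addmA : associative addm.
Proof. by move=> a b c; apply/eq0_eq; exact: models_RCA0w (env3 a b c) (ax_add_assoc #0 #1 #2). Qed.

Lemma addmC : commutative addm.
Proof. by move=> a b; apply/eq0_eq; exact: models_RCA0w (env2 a b) (ax_add_comm #0 #1). Qed.

Lemma addm0 : right_id num0 addm.
Proof. by move=> a; apply/eq0_eq; exact: models_RCA0w (env1 a) (ax_add_0 #0). Qed.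

Lemma mulmA : associative mulm.
Proof. by move=> a b c; apply/eq0_eq; exact: models_RCA0w (env3 a b c) (ax_mul_assoc #0 #1 #2). Qed.

Lemma mulmC : commutative mulm.
Proof. by move=> a b; apply/eq0_eq; exact: models_RCA0w (env2 a b) (ax_mul_comm #0 #1). Qed.

Lemma mulm0 : right_zero num0 mulm.
Proof. by move=> a; apply/eq0_eq; exact: models_RCA0w (env1 a) (ax_mul_0 #0). Qed.

Lemma mulm1 : right_id num1 mulm.
Proof. by move=> a; apply/eq0_eq; exact: models_RCA0w (env1 a) (ax_mul_1 #0). Qed.

Lemma mulmDr : right_distributive mulm addm.
Proof. by move=> a b c; apply/eq0_eq; exact: models_RCA0w (env3 a b c) (ax_distr #0 #1 #2). Qed.

Lemma ltm_irrefl a : ~ lt0 a a.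
Proof. exact: models_RCA0w (env1 a) (ax_lt_irrefl #0). Qed.

Lemma ltm_trans a b c : lt0 a b -> lt0 b c -> lt0 a c.
Proof. exact: models_RCA0w (env3 a b c) (ax_lt_trans #0 #1 #2). Qed.

Lemma ltm_total a b : lt0 a b \/ a = b \/ lt0 b a.
Proof.
case: (models_RCA0w (env2 a b) (ax_lt_total #0 #1)) => [|[/eq0_eq|]] h; first by left.
- by right; left.
- by right; right.
Qed.

Lemma ltm_add a b c : lt0 a b -> lt0 (addm a c) (addm b c).
Proof. exact: models_RCA0w (env3 a b c) (ax_lt_add #0 #1 #2). Qed.

Lemma ltm_mul a b c : lt0 num0 c -> lt0 a b -> lt0 (mulm a c) (mulm b c).
Proof. exact: models_RCA0w (env3 a b c) (ax_lt_mul #0 #1 #2). Qed.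

Lemma ltm01 : lt0 num0 num1.
Proof. exact: models_RCA0w (@enil M) (@ax_lt_0_1 []). Qed.

Lemma num1_neq0 : num1 <> num0.
Proof. by move=> e; apply: (@ltm_irrefl num0); rewrite -{2}e; exact: ltm01. Qed.

HB.instance Definition _ := gen_eqMixin (num M).
HB.instance Definition _ := gen_choiceMixin (num M).

Lemma add0m : left_id num0 addm.
Proof. by move=> a; rewrite addmC addm0. Qed.
Lemma mul1m : left_id num1 mulm.
Proof. by move=> a; rewrite mulmC mulm1. Qed.
Lemma mul0m : left_zero num0 mulm.
Proof. by move=> a; rewrite mulmC mulm0. Qed.
Lemma mulmDl : left_distributive mulm addm.
Proof. by move=> a b c; rewrite mulmC mulmDr ![mulm c _]mulmC. Qed.

HB.instance Definition _ := GRing.isNmodule.Build (num M) addmA addmC add0m.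
HB.instance Definition _ := GRing.Nmodule_isComNzSemiRing.Build (num M)
  mulmA mulmC mul1m mulmDl mul0m (introN eqP num1_neq0).

Lemma piE (s t : ty) (x : dom M s) (y : dom M t) : app (app (con (cPi s t)) x) y = x.
Proof.
apply/eq_dom_eq; have := models_RCA0w (econs x (econs y enil) : env M [s; t]) (ax_Pi #0 #1).
by rewrite sat_eqT.
Qed.

Lemma sigmaE (r s t : ty) (x : dom M (r ⇒ s ⇒ t)) (y : dom M (r ⇒ s)) (z : dom M r) :
  app (app (app (con (cSigma r s t)) x) y) z = app (app x z) (app y z).
Proof.
apply/eq_dom_eq.
have := models_RCA0w (econs x (econs y (econs z enil)) : env M [_; _; _]) (ax_Sigma #0 #1 #2).
by rewrite sat_eqT.
Qed.

Lemma eval_lam (G : list ty) (r : env M G) (s t : ty) (a : tm (s :: G) t) (x : dom M s) :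
  app (eval r (lam a)) x = eval (econs x r) a.
Proof.
elim: a => {t} [t v|t c|t u b IHb c IHc].
- move: t v; apply: var_case => [|t v].
  + by rewrite /lam /= sigmaE piE.
  + by rewrite /lam /= piE.
- by rewrite /lam /= piE.
- by rewrite -[lam _]/(tCon (cSigma _ _ _) · lam b · lam c) /= sigmaE IHb IHc.
Qed.

Definition recm (f : dom M (N ⇒ N ⇒ N)) x y : num M := app (app (app (con (cRec N)) f) x) y.

Lemma recm0 f x : recm f x 0 = x.
Proof. by apply/eq0_eq; exact: models_RCA0w (econs f (env1 x)) (ax_rec_0 #0 #1). Qed.

Lemma recmS f x y : recm f x (y + 1) = app (app f y) (recm f x y).
Proof. by apply/eq0_eq; exact: models_RCA0w (econs f (env2 x y)) (ax_rec_S #0 #1 #2). Qed.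

Lemma num_ind (G : list ty) (A : fm (N :: G)) (r : env M G) :
    qf A = true -> sat (econs (0 : num M) r) A ->
    (forall n : num M, sat (econs n r) A -> sat (econs (n + 1 : num M) r) A) ->
  forall n : num M, sat (econs n r) A.
Proof.
move=> hq h0 hS; have := models_RCA0w r (ax_ind hq).
have e0 : (fun s v => eval r (scons 𝟎 (fun _ w => tVar w) v)) = econs (0 : num M) r.
  exact: env_ext.
have eS (n : num M) : (fun s v => eval (econs n r) (scons (#0 ⊕ 𝟏) (fun _ w => tVar (VS w)) v)) =
    econs (n + 1 : num M) r by exact: env_ext.
apply; split; first by apply/sat_sub; rewrite e0.
by move=> n hn; apply/sat_sub; rewrite eS; exact: hS.
Qed.

End NumSemiring.

(* Otherwise simplification expands bracket abstraction into large combinator terms. *)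
Opaque lam.

(** Bracket abstraction gives different terms in different contexts. In an extensional model they
    have the same value once their bodies agree, which identifies the step functions passed to the
    recursor. *)
Lemma lam2_ext (M : model) (G D : list ty) (r : env M G) (r' : env M D) (s t u : ty)
    (a : tm (t :: s :: G) u) (a' : tm (t :: s :: D) u) :
    (forall x y, eval (econs y (econs x r)) a = eval (econs y (econs x r')) a') ->
  eval r (lam (lam a)) = eval r' (lam (lam a')).
Proof. by move=> h; do 2 apply: dom_ext => ?; rewrite !eval_lam. Qed.

Section EvalArith.
Variables (M : model) (G : list ty) (r : env M G).

Lemma eval_app (s t : ty) (a : tm G (s ⇒ t)) (b : tm G s) :
  eval r (a · b) = app (eval r a) (eval r b).
Proof. by []. Qed.
Lemma eval_plus (a b : tm G N) : eval r (a ⊕ b) = (eval r a : num M) + eval r b.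
Proof. by []. Qed.
Lemma eval_times (a b : tm G N) : eval r (a ⊗ b) = (eval r a : num M) * eval r b.
Proof. by []. Qed.
Lemma eval_zero : eval r 𝟎 = 0 :> num M.
Proof. by []. Qed.
Lemma eval_one : eval r 𝟏 = 1 :> num M.
Proof. by []. Qed.
Lemma eval_rec0 f (a b : tm G N) :
  eval r (rec0 f a b) = recm (eval r f) (eval r a) (eval r b).
Proof. by []. Qed.

End EvalArith.

Definition evalE := (eval_plus, eval_times, eval_zero, eval_one, eval_rec0).

(** * Primitive recursive functions of the model *)

Section NumFunctions.
Variable M : model.
Implicit Types x y n : num M.

Definition predm x : num M :=
  recm (eval (enil : env M []) (lam (lam #1))) 0 x.
Definition monusm x y : num M :=
  recm (eval (enil : env M []) (lam (lam (pred #0)))) x y.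
Definition pow2m x : num M :=
  recm (eval (enil : env M []) (lam (lam (#0 ⊕ #0)))) 1 x.
Definition trim x : num M :=
  recm (eval (enil : env M []) (lam (lam (#0 ⊕ (#1 ⊕ 𝟏))))) 0 x.
Definition pairm x y : num M := trim (x + y) + y.
Definition rootm x : num M :=
  recm (eval (enil : env M [])
    (lam (lam (#0 ⊕ monus 𝟏 (monus (tri (#0 ⊕ 𝟏)) (#1 ⊕ 𝟏)))))) 0 x.
Definition psndm x : num M := monusm x (trim (rootm x)).
Definition pfstm x : num M := monusm (rootm x) (psndm x).

Section Eval.
Variables (G : list ty) (r : env M G).

Lemma eval_pred (a : tm G N) : eval r (pred a) = predm (eval r a).
Proof. by rewrite /pred eval_app /c_pred eval_lam eval_rec0; apply: (f_equal (fun f => recm f _ _)); exact: lam2_ext. Qed.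

Lemma eval_pow2 (a : tm G N) : eval r (pow2 a) = pow2m (eval r a).
Proof. by rewrite /pow2 eval_app /c_pow2 eval_lam eval_rec0; apply: (f_equal (fun f => recm f _ _)); exact: lam2_ext. Qed.

Lemma eval_tri (a : tm G N) : eval r (tri a) = trim (eval r a).
Proof. by rewrite /tri eval_app /c_tri eval_lam eval_rec0; apply: (f_equal (fun f => recm f _ _)); exact: lam2_ext. Qed.

End Eval.

Lemma eval_monus (G : list ty) (r : env M G) (a b : tm G N) :
  eval r (monus a b) = monusm (eval r a) (eval r b).
Proof.
rewrite /monus 2!eval_app /c_monus eval_lam eval_lam eval_rec0; apply: (f_equal (fun f => recm f _ _)).
by apply: lam2_ext => x y; rewrite !eval_pred.
Qed.

Lemma eval_pair (G : list ty) (r : env M G) (a b : tm G N) :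
  eval r (pair a b) = pairm (eval r a) (eval r b).
Proof. by rewrite /pair 2!eval_app /c_pair eval_lam eval_lam eval_plus eval_tri. Qed.

Lemma eval_root (G : list ty) (r : env M G) (a : tm G N) :
  eval r (root a) = rootm (eval r a).
Proof.
rewrite /root eval_app /c_root eval_lam eval_rec0; apply: (f_equal (fun f => recm f _ _)).
by apply: lam2_ext => x y; rewrite !(evalE, eval_monus, eval_tri).
Qed.

Lemma eval_psnd (G : list ty) (r : env M G) (a : tm G N) :
  eval r (psnd a) = psndm (eval r a).
Proof. by rewrite /psnd eval_app /c_snd eval_lam eval_monus eval_tri eval_root. Qed.

Lemma eval_pfst (G : list ty) (r : env M G) (a : tm G N) :
  eval r (pfst a) = pfstm (eval r a).
Proof. by rewrite /pfst eval_app /c_fst eval_lam eval_monus eval_psnd eval_root. Qed.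

End NumFunctions.

Opaque pred monus pow2 tri pair root psnd pfst.

(** Induction for a predicate of the metatheory that a quantifier-free formula, with parameters in
    [r], defines in the model. *)
Lemma num_indP (M : model) (G : list ty) (A : fm (N :: G)) (r : env M G) (P : num M -> Prop) :
    qf A = true -> (forall n : num M, sat (econs n r) A <-> P n) ->
    P 0 -> (forall n, P n -> P (n + 1)) -> forall n, P n.
Proof.
by move=> hq hA h0 hS n; apply/hA; apply: num_ind => // [|m /hA/hS/hA //]; apply/hA.
Qed.

(** * Predecessor and truncated subtraction *)

Section NumOrder.
Variable M : model.
Implicit Types a b c d m n x y : num M.

Lemma ltmS n : lt0 n (n + 1).
Proof. by have := ltm_add n (ltm01 M); rewrite add0m addmC. Qed.

Lemma num_ge0 n : ~ lt0 n (0 : num M).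
Proof.
elim/(num_indP (A := ¬ (#0 ≺ 𝟎)) (r := @enil M)): n => //; first exact: ltm_irrefl.
by move=> n hn /(ltm_trans (ltmS n)).
Qed.

Lemma predm0 : predm (0 : num M) = 0.
Proof. exact: recm0. Qed.

Lemma predmS n : predm (n + 1) = n.
Proof. by rewrite /predm recmS eval_lam eval_lam. Qed.

(** With [pred] as an explicit witness, the alternative of zero or successor becomes quantifier-free
    and the induction is legitimate. *)
Lemma num_case n : n = 0 \/ n = predm n + 1.
Proof.
elim/(num_indP (A := #0 ≐ 𝟎 ⋎ #0 ≐ pred #0 ⊕ 𝟏) (r := @enil M)): n => //.
- by move=> n; rewrite /= eval_pred !eq0_eq.
- by left.
- by move=> n _; right; rewrite predmS.
Qed.

Lemma monusm0 a : monusm a 0 = a.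
Proof. exact: recm0. Qed.

Lemma monusmS a n : monusm a (n + 1) = predm (monusm a n).
Proof. by rewrite /monusm recmS eval_lam eval_lam eval_pred. Qed.

(** Existence of differences would be an existential induction formula; naming the difference by
    [monus] removes the quantifier. *)
Lemma ltm_monus a b : ~ lt0 b a -> a + monusm b a = b.
Proof.
elim/(num_indP (A := ¬ (#1 ≺ #0) ⊃ #0 ⊕ monus #1 #0 ≐ #1) (r := econs b (@enil M))): a => //.
- by move=> n; rewrite /= eval_monus eq0_eq.
- by rewrite monusm0 add0r.
- move=> n IH hb; have hn : ~ lt0 b n by move=> h; exact: hb (ltm_trans h (ltmS n)).
  have e := IH hn; rewrite monusmS.
  case: (num_case (monusm b n)) => h; last by rewrite -{2}e {2}h -addrA [1 + _]addrC.
  by case: hb; rewrite -e h addr0; exact: ltmS.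
Qed.

Lemma ltm_sub a b : lt0 a b -> exists d, b = a + d.
Proof.
move=> h; exists (monusm b a); rewrite ltm_monus // => h'.
exact: ltm_irrefl (ltm_trans h h').
Qed.

Definition num_osr : osemiring := @OSemiring (num M) (@lt0 M) (@ltm_irrefl M)
  (@ltm_trans M) (@ltm_total M) (@ltm_add M) (@ltm_mul M) (@ltm01 M) ltm_sub.

End NumOrder.

(* Bundling a model with an abstract field of fractions of its numbers keeps
   unification from unfolding the construction of that field. *)
Record rmodel := RModel {
  rm_model :> model;
  ratm : realFieldType;
  ofn : num rm_model -> ratm;
  ofnD : forall a b, ofn (a + b) = ofn a + ofn b;
  ofnM : forall a b, ofn (a * b) = ofn a * ofn b;
  ofn0 : ofn 0 = 0;
  ofn1 : ofn 1 = 1;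
  ofn_inj : injective ofn;
  ltmE : forall a b : num rm_model, lt0 a b <-> ofn a < ofn b;
  ratmP : forall x : ratm, exists a b c, 0 < ofn c /\ x = (ofn a - ofn b) / ofn c }.

Definition ofnE := (ofnD, ofnM, ofn0, ofn1).

Lemma rmodel_ex (M : model) : exists R : rmodel, rm_model R = M.
Proof.
pose f := @fval (num_osr M).
have f_lt (a b : num M) : lt0 a b <-> f a < f b by rewrite fval_lt.
have f_frac x : exists a b c, 0 < f c /\ x = (f a - f b) / f c.
  have [a [b [c [hc ->]]]] := frac_fieldP x; exists a, b, c; split => //.
  by rewrite -(fval0 (num_osr M)); apply/f_lt.
by exists (@RModel M _ f (@fvalD (num_osr M))
    (@fvalM (num_osr M)) (fval0 (num_osr M)) (fval1 (num_osr M)) (@fval_inj (num_osr M)) f_lt f_frac).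
Qed.

(** * Discreteness, pairing and powers of two *)

Section NumOrderField.
Variable M : rmodel.
Implicit Types a b c d m n x y : num M.

Lemma lemE a b : ~ lt0 b a <-> ofn a <= ofn b.
Proof. by rewrite ltmE leNgt; split=> [h|/negP]; first exact/negP. Qed.

Lemma ofn_ge0 n : 0 <= ofn n.
Proof. by rewrite -ofn0; apply/lemE; exact: num_ge0. Qed.

(** Discreteness: a positive difference is a number of the model other than zero, hence a
    successor. *)
Lemma ofn_ltS a b : ofn a < ofn b -> ofn a + 1 <= ofn b.
Proof.
move=> h; have /ltm_sub [d e] : lt0 a b by apply/ltmE.
case: (num_case d) => hd; last by rewrite e hd !ofnE; have := ofn_ge0 (predm d); lra.
by move: h; rewrite e hd !ofnE; lra.
Qed.

Lemma ofn_monus a b : ofn a <= ofn b -> ofn (monusm b a) = ofn b - ofn a.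
Proof. by move/lemE/ltm_monus => e; rewrite -{2}e ofnD; lra. Qed.

Lemma monus_le a b : ofn b <= ofn a -> monusm b a = 0.
Proof.
move/lemE; elim/(num_indP (A := ¬ (#0 ≺ #1) ⊃ monus #1 #0 ≐ 𝟎) (r := econs b (@enil M))): a => //.
- by move=> n; rewrite /= eval_monus eq0_eq.
- by move=> h; case: (num_case b) => [->|e]; rewrite monusm0 //;
    case: h; rewrite e ltmE !ofnE; have := ofn_ge0 (predm b); lra.
- move=> n IH /lemE; rewrite monusmS ofnD ofn1 => hb.
  have [h|/ofn_ltS h] := lerP (ofn b) (ofn n).
    by rewrite IH ?predm0 //; apply/lemE.
  suff -> : monusm b n = 0 + 1 by rewrite predmS.
  by apply: ofn_inj; rewrite ofn_monus ?ofnE; lra.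
Qed.

Lemma trim0 : trim (0 : num M) = 0.
Proof. exact: recm0. Qed.

Lemma trimS n : trim (n + 1) = trim n + (n + 1).
Proof. by rewrite /trim recmS eval_lam eval_lam. Qed.

Lemma trim_le a b : ofn a <= ofn b -> ofn (trim a) <= ofn (trim b).
Proof.
elim/(num_indP (A := ¬ (#0 ≺ #1) ⊃ ¬ (tri #0 ≺ tri #1)) (r := econs a (@enil M))): b => //.
- by move=> n; rewrite /= !eval_tri; split=> h /lemE /h /lemE.
- move=> h; have -> : a = 0 by apply: ofn_inj; move: h (ofn_ge0 a); rewrite !ofnE; lra.
  by [].
- move=> n IH; rewrite ofnD ofn1 => h.
  have [/IH h'|/ofn_ltS h'] := lerP (ofn a) (ofn n).
    by rewrite trimS !ofnE; have := ofn_ge0 n; lra.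
  have -> : a = n + 1 by apply: ofn_inj; rewrite !ofnE; lra.
  by [].
Qed.

Lemma rootmS n :
  rootm (n + 1) = rootm n + monusm 1 (monusm (trim (rootm n + 1)) (n + 1)).
Proof. by rewrite /rootm recmS eval_lam eval_lam !(evalE, eval_monus, eval_tri). Qed.

(** The two bounds form one invariant, because the recursion adds 1 exactly when the upper bound
    would fail at n + 1. *)
Lemma rootmP n : ofn (trim (rootm n)) <= ofn n /\ ofn n < ofn (trim (rootm n + 1)).
Proof.
elim/(num_indP (A := ¬ (#0 ≺ tri (root #0)) ⋏ #0 ≺ tri (root #0 ⊕ 𝟏)) (r := @enil M)): n => //.
- move=> n; rewrite /= !eval_tri evalE !eval_root.
  by split=> -[h1 h2]; split; [exact/lemE | exact/ltmE | exact/lemE | exact/ltmE].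
- by rewrite /rootm recm0 trimS trim0 !ofnE; split; lra.
- move=> n [h1 /ofn_ltS h2]; rewrite rootmS; set w := rootm n in h1 h2 *.
  have [h|h] := lerP (ofn (trim (w + 1))) (ofn (n + 1)).
    rewrite (monus_le h) monusm0; split => //.
    by rewrite trimS !ofnE; move: h; rewrite ofnD ofn1 => h; have := ofn_ge0 w; lra.
  rewrite monus_le; first by rewrite addr0; split => //; rewrite ofnD ofn1; lra.
  by rewrite ofn_monus ?ofn1; move/ofn_ltS: h; lra.
Qed.

(** The code lies between [tri (a + b)] and [tri (a + b + 1)], the latter excluded; monotonicity of
    [tri] rules out every other root. *)
Lemma rootm_pair a b : rootm (pairm a b) = a + b.
Proof.
have [h1 h2] := rootmP (pairm a b); set w := rootm _ in h1 h2 *.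
move: h1 h2; rewrite /pairm => h1 h2.
have ha := ofn_ge0 a; have hb := ofn_ge0 b.
case: (ltrgtP (ofn w) (ofn (a + b))) => [||/ofn_inj //] /ofn_ltS h; exfalso.
- have : ofn (trim (w + 1)) <= ofn (trim (a + b)) by apply: trim_le; rewrite !ofnE; move: h; rewrite !ofnE; lra.
  by move: h2; rewrite !(ofnD (trim _)); lra.
- have : ofn (trim (a + b + 1)) <= ofn (trim w) by apply: trim_le; rewrite (ofnD _ 1) ofn1.
  by move: h1; rewrite trimS !ofnE; lra.
Qed.

Lemma psndm_pair a b : psndm (pairm a b) = b.
Proof.
apply: ofn_inj; rewrite /psndm rootm_pair ofn_monus /pairm ?ofnD; have := ofn_ge0 b; lra.
Qed.

Lemma pfstm_pair a b : pfstm (pairm a b) = a.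
Proof.
apply: ofn_inj; rewrite /pfstm rootm_pair psndm_pair ofn_monus ?ofnD; have := ofn_ge0 a; lra.
Qed.

Lemma pow2m0 : pow2m (0 : num M) = 1.
Proof. exact: recm0. Qed.

Lemma pow2mS n : pow2m (n + 1) = pow2m n + pow2m n.
Proof. by rewrite /pow2m recmS eval_lam eval_lam. Qed.

Lemma pow2m_gt n : ofn n < ofn (pow2m n).
Proof.
elim/(num_indP (A := #0 ≺ pow2 #0) (r := @enil M)): n => //.
- by move=> n; rewrite /= eval_pow2 ltmE.
- by rewrite pow2m0 !ofnE; lra.
- by move=> n /ofn_ltS h; rewrite pow2mS !ofnE; have := ofn_ge0 n; lra.
Qed.

End NumOrderField.

(** * Codes of rationals *)

Lemma divf_add (F : fieldType) (a b c d a' b' : F) : c != 0 -> d != 0 ->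
  (a * d + a' * c - (b * d + b' * c)) / (c * d) = (a - b) / c + (a' - b') / d.
Proof. by move=> hc hd; field; rewrite hc hd. Qed.

Lemma divf_mul (F : fieldType) (a b c d a' b' : F) : c != 0 -> d != 0 ->
  (a * a' + b * b' - (a * b' + b * a')) / (c * d) = (a - b) / c * ((a' - b') / d).
Proof. by move=> hc hd; field; rewrite hc hd. Qed.

Section Rationals.
Variable M : rmodel.
Implicit Types a b c d m n p q s : num M.

Definition mkqm a b c : num M := pairm (pairm a b) c.
Definition posm q := pfstm (pfstm q).
Definition negm q := psndm (pfstm q).
Definition denm q := psndm q + 1.
Definition valq q : ratm M := (ofn (posm q) - ofn (negm q)) / ofn (denm q).

Definition addqm p q := mkqm (posm p * denm q + posm q * denm p)
  (negm p * denm q + negm q * denm p) (predm (denm p * denm q)).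
Definition oppqm q := mkqm (negm q) (posm q) (psndm q).
Definition mulqm p q := mkqm (posm p * posm q + negm p * negm q)
  (posm p * negm q + negm p * posm q) (predm (denm p * denm q)).
Definition absqm q := mkqm (monusm (posm q) (negm q) + monusm (negm q) (posm q)) 0 (psndm q).

Lemma denm_gt0 q : 0 < ofn (denm q).
Proof. by rewrite /denm !ofnE; have := ofn_ge0 (psndm q); lra. Qed.

Lemma ofn_pred n : 0 < ofn n -> ofn (predm n) + 1 = ofn n.
Proof.
by move=> h; case: (num_case n) => e; [move: h; rewrite e ofn0 ltxx | rewrite {2}e !ofnE].
Qed.

Lemma valq_mk a b c : valq (mkqm a b c) = (ofn a - ofn b) / (ofn c + 1).
Proof. by rewrite /valq /posm /negm /denm /mkqm !(pfstm_pair, psndm_pair) !ofnE. Qed.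

Lemma valq_add p q : valq (addqm p q) = valq p + valq q.
Proof.
rewrite /addqm valq_mk /valq; move: (denm p) (denm q) (denm_gt0 p) (denm_gt0 q) => c d hc hd.
rewrite ofn_pred ?ofnM ?mulr_gt0 // !ofnE.
by rewrite divf_add // gt_eqF.
Qed.

Lemma valq_opp q : valq (oppqm q) = - valq q.
Proof. by rewrite /oppqm valq_mk /valq /denm !ofnE -mulNr opprB. Qed.

Lemma valq_mul p q : valq (mulqm p q) = valq p * valq q.
Proof.
rewrite /mulqm valq_mk /valq; move: (denm p) (denm q) (denm_gt0 p) (denm_gt0 q) => c d hc hd.
rewrite ofn_pred ?ofnM ?mulr_gt0 // !ofnE.
by rewrite divf_mul // gt_eqF.
Qed.

Lemma valq_abs q : valq (absqm q) = `|valq q|.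
Proof.
rewrite /absqm valq_mk /valq normrM normfV /denm !ofnE.
rewrite (gtr0_norm (x := ofn (psndm q) + 1)); last by have := ofn_ge0 (psndm q); lra.
congr (_ / _); rewrite subr0.
have [h|/ltW h] := lerP (ofn (posm q)) (ofn (negm q)).
  by rewrite (monus_le h) ofn_monus // ofn0 add0r.
by rewrite (monus_le h) ofn_monus // ofn0 addr0.
Qed.

Lemma valq_surj (x : ratm M) : exists q, valq q = x.
Proof.
have [a [b [c [hc ->]]]] := ratmP x.
by exists (mkqm a b (predm c)); rewrite valq_mk ofn_pred.
Qed.

Definition eps n : ratm M := (ofn (pow2m n))^-1.

Lemma pow2m_gt0 n : 0 < ofn (pow2m n).
Proof. exact: le_lt_trans (ofn_ge0 _) (pow2m_gt n). Qed.

Lemma eps_gt0 n : 0 < eps n.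
Proof. by rewrite invr_gt0 pow2m_gt0. Qed.

Lemma epsS n : eps (n + 1) = eps n / 2.
Proof. by rewrite /eps pow2mS ofnD -mulr2n -(mulr_natr (ofn _)) invfM. Qed.

Lemma pow2m_le a b : ofn a <= ofn b -> ofn (pow2m a) <= ofn (pow2m b).
Proof.
elim/(num_indP (A := ¬ (#0 ≺ #1) ⊃ ¬ (pow2 #0 ≺ pow2 #1)) (r := econs a (@enil M))): b => //.
- by move=> n; rewrite /= !eval_pow2; split=> h /lemE /h /lemE.
- move=> h; have -> : a = 0 by apply: ofn_inj; move: h (ofn_ge0 a); rewrite !ofnE; lra.
  by [].
- move=> n IH; rewrite ofnD ofn1 => h.
  have [/IH h'|/ofn_ltS h'] := lerP (ofn a) (ofn n).
    by rewrite pow2mS !ofnE; have := ofn_ge0 (pow2m n); lra.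
  have -> : a = n + 1 by apply: ofn_inj; rewrite !ofnE; lra.
  by [].
Qed.

Lemma eps_le a b : ofn a <= ofn b -> eps b <= eps a.
Proof. by move=> /pow2m_le h; rewrite /eps lef_pV2 ?posrE ?pow2m_gt0. Qed.

Lemma eps_addl a b : eps (a + b) <= eps a.
Proof. by apply: eps_le; rewrite ofnD; have := ofn_ge0 b; lra. Qed.

Lemma ofn_eps n : ofn n * eps n <= 1.
Proof. by rewrite ler_pdivrMr ?pow2m_gt0 // mul1r ltW // pow2m_gt. Qed.

(** The Archimedean property relative to the numbers of the model: by discreteness a positive
    fraction with denominator c is at least 1 / c, and c < 2^(c + 1). *)
Lemma eps_small (x : ratm M) : 0 < x -> exists n, eps n < x.
Proof.
move=> hx; have [a [b [c [hc e]]]] := ratmP x.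
exists (c + 1); apply: (@lt_le_trans _ _ (ofn c)^-1).
  rewrite /eps ltf_pV2 ?posrE ?pow2m_gt0 //.
  by apply: lt_trans (pow2m_gt _); rewrite ofnD ofn1; lra.
rewrite e -[leLHS]mul1r ler_pM2r ?invr_gt0 //.
have : ofn b < ofn a by move: hx; rewrite e pmulr_lgt0 ?invr_gt0 // subr_gt0.
by move/ofn_ltS; lra.
Qed.

Section Eval.
Variables (G : list ty) (r : env M G).

Lemma eval_mkQ (a b c : tm G N) :
  eval r (mkQ a b c) = mkqm (eval r a) (eval r b) (eval r c).
Proof. by rewrite /mkQ !eval_pair. Qed.

Lemma eval_posQ (q : tm G N) : eval r (posQ q) = posm (eval r q).
Proof. by rewrite /posQ !eval_pfst. Qed.

Lemma eval_negQ (q : tm G N) : eval r (negQ q) = negm (eval r q).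
Proof. by rewrite /negQ eval_psnd eval_pfst. Qed.

Lemma eval_denQ (q : tm G N) : eval r (denQ q) = denm (eval r q).
Proof. by rewrite /denQ eval_plus eval_psnd. Qed.

Lemma sat_lt (a b : tm G N) : sat r (a ≺ b) <-> lt0 (eval r a) (eval r b).
Proof. by []. Qed.

Lemma sat_not (A : fm G) : sat r (¬ A) <-> ~ sat r A.
Proof. by []. Qed.

Lemma sat_ltQ (q s : tm G N) : sat r (ltQ q s) <-> valq (eval r q) < valq (eval r s).
Proof.
have -> : sat r (ltQ q s) <->
    lt0 (posm (eval r q) * denm (eval r s) + negm (eval r s) * denm (eval r q))
        (posm (eval r s) * denm (eval r q) + negm (eval r q) * denm (eval r s)).
  by rewrite /ltQ sat_lt !(eval_posQ, eval_negQ, eval_denQ, eval_times, eval_plus).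
rewrite ltmE /valq; move: (eval r q) (eval r s) => p t.
move: (denm p) (denm t) (denm_gt0 p) (denm_gt0 t) => c d hc hd.
rewrite !ofnE ltr_pdivrMr // mulrAC ltr_pdivlMr // !mulrBl ltrBlDr addrAC ltrBrDr.
by [].
Qed.

Lemma sat_leQ (q s : tm G N) : sat r (leQ q s) <-> valq (eval r q) <= valq (eval r s).
Proof.
by rewrite /leQ sat_not sat_ltQ leNgt; split => /negP.
Qed.

End Eval.

Section EvalFunctions.
Variables (G : list ty) (r : env M G).

Lemma eval_addQ (q s : tm G N) : eval r (addQ q s) = addqm (eval r q) (eval r s).
Proof.
rewrite /addQ 2!eval_app /c_addQ 2!eval_lam eval_mkQ.
by rewrite !(eval_posQ, eval_negQ, eval_denQ, eval_pred, eval_times, eval_plus).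
Qed.

Lemma eval_mulQ (q s : tm G N) : eval r (mulQ q s) = mulqm (eval r q) (eval r s).
Proof.
rewrite /mulQ 2!eval_app /c_mulQ 2!eval_lam eval_mkQ.
by rewrite !(eval_posQ, eval_negQ, eval_denQ, eval_pred, eval_times, eval_plus).
Qed.

Lemma eval_oppQ (q : tm G N) : eval r (c_oppQ · q) = oppqm (eval r q).
Proof. by rewrite eval_app /c_oppQ eval_lam eval_mkQ eval_posQ eval_negQ eval_psnd. Qed.

Lemma eval_absQ (q : tm G N) : eval r (absQ q) = absqm (eval r q).
Proof.
rewrite /absQ eval_app /c_absQ eval_lam eval_mkQ eval_plus !eval_monus eval_psnd.
by rewrite eval_posQ eval_negQ.
Qed.

Lemma valq_addQ (q s : tm G N) :
  valq (eval r (addQ q s)) = valq (eval r q) + valq (eval r s).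
Proof. by rewrite eval_addQ valq_add. Qed.

Lemma valq_oppQ (q : tm G N) : valq (eval r (c_oppQ · q)) = - valq (eval r q).
Proof. by rewrite eval_oppQ valq_opp. Qed.

Lemma valq_subQ (q s : tm G N) :
  valq (eval r (subQ q s)) = valq (eval r q) - valq (eval r s).
Proof. by rewrite valq_addQ valq_oppQ. Qed.

Lemma valq_mulQ (q s : tm G N) :
  valq (eval r (mulQ q s)) = valq (eval r q) * valq (eval r s).
Proof. by rewrite eval_mulQ valq_mul. Qed.

Lemma valq_absQ (q : tm G N) : valq (eval r (absQ q)) = `|valq (eval r q)|.
Proof. by rewrite eval_absQ valq_abs. Qed.

Lemma valq_mkQ (a b c : tm G N) :
  valq (eval r (mkQ a b c)) = (ofn (eval r a) - ofn (eval r b)) / (ofn (eval r c) + 1).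
Proof. by rewrite eval_mkQ valq_mk. Qed.

Lemma valq_nat (a : tm G N) : valq (eval r (mkQ a 𝟎 𝟎)) = ofn (eval r a).
Proof. by rewrite valq_mkQ !evalE !ofnE subr0 add0r divr1. Qed.

Lemma valq_dyadic (a n : tm G N) :
  valq (eval r (dyadic a n)) = ofn (eval r a) * eps (eval r n).
Proof.
rewrite valq_mkQ eval_pred eval_pow2 evalE ofn0 subr0 ofn_pred //.
exact: pow2m_gt0.
Qed.

End EvalFunctions.
End Rationals.

Opaque addQ subQ mulQ absQ mkQ dyadic ltQ leQ.

(** * Codes of reals *)

Section Reals.
Variable M : rmodel.
Implicit Types (a b i j k m n p : num M) (u v : num M -> ratm M).

(* Real numbers are handled through the sequence of the values of their rational codes. *)
Definition vr (x : dom M T1) n : ratm M := valq (app x n).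

Definition realm u := forall m n, `|u m - u (m + n)| < eps m.
Definition eqm u v := forall n, `|u n - v n| <= 2 * eps n.
Definition lem u v := forall n, u n <= v n + 2 * eps n.
Definition in01m u := realm u /\ lem (fun=> 0) u /\ lem u (fun=> 1).
Definition posm_real u := realm u /\ ~ lem u (fun=> 0).

Lemma two_eps (G : list ty) (r : env M G) (n : tm G N) :
  valq (eval r (dyadic (𝟏 ⊕ 𝟏) n)) = 2 * eps (eval r n).
Proof. by rewrite valq_dyadic !evalE !ofnE. Qed.

Section Sat.
Variables (G : list ty) (r : env M G).
Implicit Types x y : tm G T1.

Lemma eval_wk2 (s t u : ty) (a : tm G s) (x : dom M t) (y : dom M u) :
  eval (econs x (econs y r)) a↑↑ = eval r a.
Proof. by rewrite !eval_wk. Qed.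

Lemma sat_is_real x : sat r (is_real x) <-> realm (vr (eval r x)).
Proof.
have E m n : sat (econs n (econs m r) : env M [:: N, N & G])
      (ltQ (absQ (subQ (x↑↑ · #1) (x↑↑ · (#1 ⊕ #0)))) (dyadic 𝟏 #1)) <->
    `|vr (eval r x) m - vr (eval r x) (m + n)| < eps m.
  rewrite sat_ltQ valq_absQ valq_subQ valq_dyadic 2!eval_app eval_wk2 evalE.
  by rewrite evalE ofn1 mul1r.
by split => h m n; apply/E; exact: h.
Qed.

Lemma sat_eqR x y : sat r (eqR x y) <-> eqm (vr (eval r x)) (vr (eval r y)).
Proof.
have E n : sat (econs n r : env M (N :: G))
      (leQ (absQ (subQ (x↑ · #0) (y↑ · #0))) (dyadic (𝟏 ⊕ 𝟏) #0)) <->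
    `|vr (eval r x) n - vr (eval r y) n| <= 2 * eps n.
  by rewrite sat_leQ valq_absQ valq_subQ two_eps 2!eval_app !eval_wk.
by split => h n; apply/E; exact: h.
Qed.

Lemma sat_leR x y : sat r (leR x y) <-> lem (vr (eval r x)) (vr (eval r y)).
Proof.
have E n : sat (econs n r : env M (N :: G))
      (leQ (x↑ · #0) (addQ (y↑ · #0) (dyadic (𝟏 ⊕ 𝟏) #0))) <->
    vr (eval r x) n <= vr (eval r y) n + 2 * eps n.
  by rewrite sat_leQ valq_addQ two_eps 2!eval_app !eval_wk.
by split => h n; apply/E; exact: h.
Qed.

Lemma sat_ltR x y : sat r (ltR x y) <-> ~ lem (vr (eval r y)) (vr (eval r x)).
Proof. by rewrite /ltR sat_not sat_leR. Qed.

Lemma vr_natR (a : tm G N) : vr (eval r (natR a)) = fun=> ofn (eval r a).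
Proof. by apply/funext => n; rewrite /vr /natR eval_lam valq_nat eval_wk. Qed.

Lemma vr_addR x y : vr (eval r (addR x y)) = fun n => vr (eval r x) (n + 1) + vr (eval r y) (n + 1).
Proof. by apply/funext => n; rewrite /vr /addR 2!eval_app /c_addR 3!eval_lam valq_addQ. Qed.

Lemma vr_oppR x : vr (eval r (c_oppR · x)) = fun n => - vr (eval r x) n.
Proof. by apply/funext => n; rewrite /vr eval_app /c_oppR 2!eval_lam valq_oppQ. Qed.

Lemma vr_subR x y : vr (eval r (subR x y)) = fun n => vr (eval r x) (n + 1) - vr (eval r y) (n + 1).
Proof. by rewrite vr_addR vr_oppR. Qed.

Lemma vr_absR x : vr (eval r (absR x)) = fun n => `|vr (eval r x) n|.
Proof. by apply/funext => n; rewrite /vr /absR eval_app /c_absR 2!eval_lam valq_absQ. Qed.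

(** The shift [s] of the index is left abstract; the estimates for Riemann sums hold for every value
    of it. *)
Lemma vr_mulR x y : exists s : num M,
  vr (eval r (mulR x y)) = fun n => vr (eval r x) (n + s) * vr (eval r y) (n + s).
Proof.
exists (eval (econs (eval r y) (econs (eval r x) r) : env M [:: T1, T1 & G])
  (boundQ (#1 · 𝟎) ⊕ boundQ (#0 · 𝟎))).
apply/funext => n; rewrite /vr /mulR 2!eval_app /c_mulR 3!eval_lam valq_mulQ.
rewrite [eval _ (#2 · (_ ⊕ _))]eval_app [eval _ (#1 · (_ ⊕ _))]eval_app.
rewrite !(eval_posQ, eval_negQ, eval_plus).
by [].
Qed.

Lemma sat_pos_real x : sat r (pos_real x) <-> posm_real (vr (eval r x)).
Proof.
have -> : sat r (pos_real x) <-> sat r (is_real x) /\ sat r (ltR (natR 𝟎) x) by [].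
by rewrite sat_is_real sat_ltR vr_natR evalE ofn0.
Qed.

Lemma sat_in01 x : sat r (in01 x) <-> in01m (vr (eval r x)).
Proof.
have -> : sat r (in01 x) <->
  sat r (is_real x) /\ sat r (leR (natR 𝟎) x) /\ sat r (leR x (natR 𝟏)) by [].
by rewrite sat_is_real !sat_leR !vr_natR !evalE ofn0 ofn1.
Qed.

End Sat.

(** The number of summands is an element of the model, possibly nonstandard, so the sum is an
    internal recursion. *)
Definition sumv (u : dom M T1) j : ratm M :=
  valq (recm (eval (econs u enil : env M [T1]) (lam (lam (addQ #0 (#2 · #1))))) (mkqm 0 0 0) j).

Lemma sumv0 (u : dom M T1) : sumv u 0 = 0.
Proof. by rewrite /sumv recm0 valq_mk ofn0 subrr mul0r. Qed.

Lemma sumvS (u : dom M T1) j : sumv u (j + 1) = sumv u j + vr u j.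
Proof. by rewrite /sumv recmS 2!eval_lam valq_addQ eval_app. Qed.

Definition column (z : dom M (N ⇒ T1)) p : dom M T1 :=
  eval (econs z (econs p enil) : env M [:: N ⇒ T1; N]) (lam (#1 · #0 · #2)).

Lemma vr_column z p : vr (column z p) = fun i => vr (app z i) p.
Proof. by apply/funext => i; rewrite /vr /column eval_lam 2!eval_app. Qed.

(** For each n, all summands are taken at the same precision n + k, so a sum of reals is reduced to
    sums of rationals along one column. *)
Lemma vr_sumR (G : list ty) (r : env M G) (z : tm G (N ⇒ T1)) (k : tm G N) :
  vr (eval r (sumR z k)) = fun n => sumv (column (eval r z) (n + eval r k)) (eval r k).
Proof.
apply/funext => n; rewrite /vr /sumR 2!eval_app /c_sumR 3!eval_lam.
rewrite /sumv eval_rec0 eval_mkQ; apply: (f_equal (fun f => valq (recm f _ _))).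
apply: lam2_ext => x y; rewrite 2!eval_addQ; apply: (f_equal (addqm _)).
by rewrite 2!eval_app [RHS]eval_app /column eval_lam 2!eval_app.
Qed.

End Reals.

(** * Induction for inequalities between rationals, sums and counting *)

Section Definable.
Variable M : rmodel.
Implicit Types (a b c i j k m n p : num M) (f g : num M -> ratm M) (u : dom M T1).

(** The functions about which inequalities may be proved by induction: those given by an object of
    type 1 of the model. The closure lemmas below write down the required terms. *)
Definition defq f := exists u, vr u = f.

Let env1 u : env M [T1] := econs u enil.
Let env2 u u' : env M [:: T1; T1] := econs u (env1 u').

Lemma defq_vr u : defq (vr u).
Proof. by exists u. Qed.

Lemma defq_const (x : ratm M) : defq (fun=> x).
Proof.
have [q <-] := valq_surj x; exists (eval (econs q enil : env M [N]) (lam #1)).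
by apply/funext => n; rewrite /vr eval_lam.
Qed.

Lemma defq_ofn : defq (@ofn M).
Proof.
exists (eval (enil : env M []) (lam (mkQ #0 𝟎 𝟎))).
by apply/funext => n; rewrite /vr eval_lam valq_nat.
Qed.

Lemma defq_add f g : defq f -> defq g -> defq (fun n => f n + g n).
Proof.
move=> [u <-] [u' <-]; exists (eval (env2 u u') (lam (addQ (#1 · #0) (#2 · #0)))).
by apply/funext => n; rewrite /vr eval_lam valq_addQ 2!eval_app.
Qed.

Lemma defq_sub f g : defq f -> defq g -> defq (fun n => f n - g n).
Proof.
move=> [u <-] [u' <-]; exists (eval (env2 u u') (lam (subQ (#1 · #0) (#2 · #0)))).
by apply/funext => n; rewrite /vr eval_lam valq_subQ 2!eval_app.
Qed.

Lemma defq_mul f g : defq f -> defq g -> defq (fun n => f n * g n).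
Proof.
move=> [u <-] [u' <-]; exists (eval (env2 u u') (lam (mulQ (#1 · #0) (#2 · #0)))).
by apply/funext => n; rewrite /vr eval_lam valq_mulQ 2!eval_app.
Qed.

Lemma defq_abs f : defq f -> defq (fun n => `|f n|).
Proof.
move=> [u <-]; exists (eval (env1 u) (lam (absQ (#1 · #0)))).
by apply/funext => n; rewrite /vr eval_lam valq_absQ eval_app.
Qed.

Lemma defq_shift f a : defq f -> defq (fun n => f (a + n)).
Proof.
move=> [u <-]; exists (eval (econs a (env1 u) : env M [:: N; T1]) (lam (#2 · (#1 ⊕ #0)))).
by apply/funext => n; rewrite /vr eval_lam eval_app.
Qed.

Lemma defq_column (x : dom M (N ⇒ T1)) p : defq (fun n => vr (app x n) p).
Proof. by exists (column x p); rewrite vr_column. Qed.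

Lemma defq_sumv u : defq (sumv u).
Proof.
exists (eval (env1 u) (lam (rec0 (lam (lam (addQ #0 (#3 · #1)))) (mkQ 𝟎 𝟎 𝟎) #0))).
apply/funext => n; rewrite /vr /sumv eval_lam eval_rec0 eval_mkQ.
have e : eval (econs n (env1 u)) (lam (lam (addQ #0 (#3 · #1)))) =
    eval (env1 u) (lam (lam (addQ #0 (#2 · #1)))).
  by apply: lam2_ext => x y; rewrite 2!eval_addQ 2!eval_app.
by rewrite e.
Qed.

(** Truncated subtraction provides the characteristic function of the order as a term; all indicator
    functions below are built from it. *)
Lemma ofn_monus1 a b : ofn (monusm 1 (monusm a b)) = (ofn a <= ofn b)%R%:R.
Proof.
have [h|h] := lerP (ofn a) (ofn b).
  by rewrite (monus_le h) monusm0 ofn1.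
rewrite monus_le ?ofn0 // ofn_monus ?ofn1 ?(ltW h) //.
by have := ofn_ltS h; lra.
Qed.

Definition leqv (y : dom M T1) b : dom M T1 :=
  eval (econs b (env1 y) : env M [:: N; T1]) (lam (mkQ (monus 𝟏 (monus (#2 · #0) #1)) 𝟎 𝟎)).

Lemma vr_leqv y b : vr (leqv y b) = fun i => (ofn (app y i : num M) <= ofn b)%R%:R.
Proof.
apply/funext => n.
by rewrite /vr /leqv eval_lam valq_nat 2!eval_monus eval_one eval_app ofn_monus1.
Qed.

(** The variable here is the threshold, with the number of summands fixed: the induction in
    [count_le] runs over thresholds. *)
Lemma defq_sumv_leqv y k : defq (fun n => sumv (leqv y n) k).
Proof.
exists (eval (econs k (env1 y) : env M [:: N; T1])
  (lam (rec0 (lam (lam (addQ #0 (mkQ (monus 𝟏 (monus (#4 · #1) #2)) 𝟎 𝟎)))) (mkQ 𝟎 𝟎 𝟎) #1))).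
apply/funext => n; rewrite /vr /sumv eval_lam eval_rec0 eval_mkQ.
have e : eval (econs n (econs k (env1 y)))
    (lam (lam (addQ #0 (mkQ (monus 𝟏 (monus (#4 · #1) #2)) 𝟎 𝟎)))) =
  eval (env1 (leqv y n)) (lam (lam (addQ #0 (#2 · #1)))).
  apply: lam2_ext => i s; rewrite 2!eval_addQ; apply: (f_equal (addqm _)).
  by rewrite [RHS]eval_app /leqv eval_lam 2!eval_mkQ 4!eval_monus 2!eval_app.
by rewrite e.
Qed.

Lemma defq_ge (u : dom M T1) b : defq (fun i => (ofn b <= ofn (app u i : num M))%R%:R).
Proof.
exists (eval (econs b (env1 u) : env M [:: N; T1])
  (lam (mkQ (monus 𝟏 (monus #1 (#2 · #0))) 𝟎 𝟎))).
apply/funext => n.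
by rewrite /vr eval_lam valq_nat 2!eval_monus eval_one eval_app ofn_monus1.
Qed.

(** For definable [f] and [g] the inequality compares two codes and is quantifier-free. The bound j
    <= k belongs to the induction formula, so the step may use facts that hold only below [k]. *)
Lemma ratm_ind k f g : defq f -> defq g -> f 0 <= g 0 ->
    (forall j, ofn j < ofn k -> f j <= g j -> f (j + 1) <= g (j + 1)) ->
  forall j, ofn j <= ofn k -> f j <= g j.
Proof.
move=> [u <-] [u' <-] h0 hS j.
elim/(num_indP (A := ¬ (#1 ≺ #0) ⊃ leQ (#2 · #0) (#3 · #0))
  (r := econs k (env2 u u') : env M [:: N; T1; T1])): j => [||_|n IH hn] //.
- move=> n; have E : sat (econs n (econs k (env2 u u')) : env M [:: N; N; T1; T1])
      (leQ (#2 · #0) (#3 · #0)) <-> vr u n <= vr u' n by rewrite sat_leQ 2!eval_app.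
  by split=> h /lemE /h /E.
- move: hn; rewrite ofnD ofn1 => hn.
  by apply: hS; [lra | apply: IH; lra].
Qed.

Lemma defq_eq (y : dom M T1) b : defq (fun i => ((app y i : num M) == b)%:R).
Proof.
have := defq_mul (defq_vr (leqv y b)) (defq_ge y b); congr defq; apply/funext => i.
rewrite vr_leqv -natrM mulnb -eq_le; congr ((_ : bool)%:R).
by apply/eqP/eqP => [/ofn_inj|->].
Qed.

End Definable.

Section Sums.
Variable M : rmodel.
Implicit Types (a b c i j k m n p : num M) (u w y : dom M T1) (D e : ratm M).

Lemma sumv_telescope u w e k :
    (forall i, ofn i < ofn k -> `|vr u i - (vr w (i + 1) - vr w i)| <= e) ->
  `|sumv u k - (vr w k - vr w 0)| <= ofn k * e.
Proof.
move=> h; apply: (ratm_ind (k := k) (f := fun j => `|sumv u j - (vr w j - vr w 0)|)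
  (g := fun j => ofn j * e)) => //.
- apply: defq_abs; apply: defq_sub; first exact: defq_sumv.
  by apply: defq_sub; [exact: defq_vr | exact: defq_const].
- by apply: defq_mul; [exact: defq_ofn | exact: defq_const].
- by rewrite sumv0 subrr subr0 normr0 ofn0 mul0r.
- move=> j /h; rewrite sumvS ofnD ofn1 !ler_norml => /andP [h1 h2] /andP [h3 h4].
  by apply/andP; split; lra.
Qed.

Lemma sumv_dominated u w D k :
    (forall i, ofn i < ofn k -> `|vr u i| <= D * vr w i) ->
  `|sumv u k| <= D * sumv w k.
Proof.
move=> h; apply: (ratm_ind (k := k) (f := fun j => `|sumv u j|)
  (g := fun j => D * sumv w j)) => //.
- by apply: defq_abs; exact: defq_sumv.
- by apply: defq_mul; [exact: defq_const | exact: defq_sumv].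
- by rewrite !sumv0 normr0 mulr0.
- move=> j /h h1 h2; rewrite !sumvS mulrDr; apply: le_trans (ler_normD _ _) _.
  exact: lerD.
Qed.

Lemma sumv_delta a : exists u, vr u = (fun i => (i == a)%:R) /\ forall k, sumv u k <= 1.
Proof.
pose idm : dom M T1 := eval (enil : env M []) (lam #0).
have idE i : app idm i = i by rewrite /idm eval_lam.
have [u hu] := defq_eq idm a; exists u.
have {}hu : vr u = fun i => (i == a)%:R by rewrite hu; apply/funext => i; rewrite idE.
split => // k.
have hg := defq_ge idm (a + 1).
(* The bound 1 is not preserved by the induction step; the indicator of a + 1 <= k is, and it is at
   most 1. *)
have : sumv u k <= (ofn (a + 1) <= ofn (app idm k : num M))%R%:R.
  apply: (ratm_ind (k := k) (f := sumv u) (g := fun j => (ofn (a + 1) <= ofn (app idm j : num M))%R%:R)) => //.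
  - exact: defq_sumv.
  - by rewrite sumv0 ler0n.
  - move=> j _; rewrite !idE sumvS hu !ofnE => h.
    case: (eqVneq j a) h => [->|_] h.
      by move: h; rewrite lexx; case: (lerP (ofn a + 1)) => [h1|_] /= h; lra.
    rewrite addr0; apply: le_trans h _.
    by rewrite ler_nat; case: lerP => //= h; case: lerP => //=; lra.
by move/le_trans; apply; rewrite lern1 leq_b1.
Qed.

(** If some index i carries the value [c], any other such index is adjacent to i, so the indicator
    of [c] is dominated by the sum of three point indicators. If there is no such index, the sum is
    at most 0. *)
Lemma count_eq y c k u :
    vr u = (fun i => ((app y i : num M) == c)%:R) ->
    (forall i j, ofn i < ofn k -> ofn j < ofn k -> app y i = app y j -> ofn j <= ofn i + 1) ->
  sumv u k <= 3.
Proof.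
move=> hu hy.
have [[i [hi ei]]|hn] := pselect (exists i, ofn i < ofn k /\ app y i = c); last first.
  apply: (le_trans (y := 0)); last by [].
  apply: (ratm_ind (k := k) (f := sumv u) (g := fun=> 0)) => //.
  - exact: defq_sumv.
  - exact: defq_const.
  - by rewrite sumv0.
  - move=> j hj h; rewrite sumvS hu; case: eqP => [e|_]; last by rewrite addr0.
    by case: hn; exists j.
(* For i = 0 this is the index 0 again, which does not spoil the upper bound. *)
have [u0 [h0 s0]] := sumv_delta (predm i).
have [u1 [h1 s1]] := sumv_delta i.
have [u2 [h2 s2]] := sumv_delta (i + 1).
apply: (le_trans (y := sumv u0 k + sumv u1 k + sumv u2 k)); last first.
  by have := s0 k; have := s1 k; have := s2 k; lra.
apply: (ratm_ind (k := k) (f := sumv u) (g := fun j => sumv u0 j + sumv u1 j + sumv u2 j)) => //.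
- exact: defq_sumv.
- by do 2 (apply: defq_add; last exact: defq_sumv); exact: defq_sumv.
- by rewrite !sumv0 !addr0.
- move=> j hj IH; rewrite !sumvS hu h0 h1 h2.
  suff : ((app y j : num M) == c)%:R <= (j == predm i)%:R + (j == i)%:R + (j == i + 1)%:R :> ratm M.
    by move: IH; lra.
  case: eqP => [e|_]; last by rewrite !addr_ge0.
  have h3 := hy _ _ hi hj (etrans ei (esym e)).
  have h4 := hy _ _ hj hi (etrans e (esym ei)).
  have p0 := ler0n (ratm M) (j == predm i).
  have p2 := ler0n (ratm M) (j == i + 1).
  have [n1|n1] := eqVneq j i; first by rewrite /=; lra.
  have [n2|n2] := eqVneq j (i + 1); first by rewrite /=; lra.
  suff -> : j = predm i by rewrite eqxx /=; lra.
  have [l1|l1|/ofn_inj l1] := ltrgtP (ofn j) (ofn i); last by rewrite l1 eqxx in n1.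
    have ej : ofn i = ofn j + 1 by have := ofn_ltS l1; lra.
    by have -> : i = j + 1; [apply: ofn_inj; rewrite !ofnE | rewrite predmS].
  have ej : ofn j = ofn i + 1 by have := ofn_ltS l1; lra.
  by case/eqP: n2; apply: ofn_inj; rewrite !ofnE.
Qed.

(** Raising the threshold from m to m + 1 adds only the indices with value m + 1, at most three of
    them by [count_eq]. *)
Lemma count_le y n k :
    (forall i j, ofn i < ofn k -> ofn j < ofn k -> app y i = app y j -> ofn j <= ofn i + 1) ->
  sumv (leqv y n) k <= 3 * (ofn n + 1).
Proof.
move=> hy; apply: (ratm_ind (k := n) (f := fun n => sumv (leqv y n) k)
  (g := fun n => 3 * (ofn n + 1))) => //.
- exact: defq_sumv_leqv.
- apply: defq_mul; first exact: defq_const.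
  by apply: defq_add; [exact: defq_ofn | exact: defq_const].
- rewrite ofn0 add0r mulr1; apply: (count_eq (y := y) (c := 0)) => //.
  rewrite vr_leqv; apply/funext => i; rewrite ofn0; congr ((_ : bool)%:R).
  by apply/idP/eqP => [h|->]; [apply: ofn_inj; rewrite ofn0; have := ofn_ge0 (app y i : num M); lra | rewrite ofn0].
- move=> m _ IH; have [u hu] := defq_eq y (m + 1).
  have := count_eq hu hy; rewrite ofnD ofn1.
  suff : sumv (leqv y (m + 1)) k <= sumv (leqv y m) k + sumv u k by lra.
  apply: (ratm_ind (k := k) (f := sumv (leqv y (m + 1))) (g := fun k => sumv (leqv y m) k + sumv u k)) => //.
  + exact: defq_sumv.
  + by apply: defq_add; exact: defq_sumv.
  + by rewrite !sumv0 addr0.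
  + move=> j _ h; rewrite !sumvS !vr_leqv hu.
    suff : (ofn (app y j : num M) <= ofn (m + 1))%R%:R <=
      (ofn (app y j : num M) <= ofn m)%R%:R + ((app y j : num M) == m + 1)%:R :> ratm M by lra.
    have l1 : (ofn (app y j : num M) <= ofn (m + 1))%R%:R <= 1 :> ratm M by rewrite lern1 leq_b1.
    have l2 := ler0n (ratm M) ((app y j : num M) == m + 1).
    case: (lerP (ofn (app y j : num M)) (ofn m)) => h1; first by rewrite /=; lra.
    case: (lerP (ofn (app y j : num M)) (ofn (m + 1))) => h2; last by rewrite /=; lra.
    suff -> : (app y j : num M) = m + 1 by rewrite eqxx /=; lra.
    by apply: ofn_inj; move: h2; have := ofn_ltS h1; rewrite ofnD ofn1; lra.
Qed.

End Sums.

(** * Riemann sums *)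

Section Integrals.
Variable M : rmodel.
Implicit Types (a b i j k m n p : num M) (u v : num M -> ratm M).
Implicit Types (f : dom M (T1 ⇒ T1)) (x t z : dom M (N ⇒ T1)).

Lemma pow2m_add a b : pow2m (a + b) = pow2m a * pow2m b.
Proof.
elim/(num_indP (A := pow2 (#1 ⊕ #0) ≐ pow2 #1 ⊗ pow2 #0) (r := econs a (@enil M))): b => //.
- move=> n; have -> : forall r (c d : tm [N; N] N), sat (M := M) r (c ≐ d) <-> eval r c = eval r d.
    by move=> r c d; exact: eq0_eq.
  by rewrite eval_times 3!eval_pow2.
- by rewrite addr0 pow2m0 mulr1.
- by move=> n IH; rewrite addrA !pow2mS IH mulrDr.
Qed.

Lemma eps_add a b : eps (a + b) = eps a * eps b.
Proof. by rewrite /eps pow2m_add ofnM invfM. Qed.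

Lemma eps_lt (C e : ratm M) : 0 < C -> 0 < e -> exists n, C * eps n < e.
Proof.
move=> hC he; have [n hn] := @eps_small M (e / C) (divr_gt0 he hC).
by exists n; rewrite mulrC -ltr_pdivlMr.
Qed.

Lemma realm_dist u m n : realm u -> `|u m - u n| <= eps m + eps n.
Proof.
move=> hu.
have h m' n' : ofn m' <= ofn n' -> `|u m' - u n'| <= eps m' + eps n'.
  move=> /lemE /ltm_monus <-; apply: ltW; apply: lt_le_trans (hu _ _) _.
  by rewrite lerDl ltW // eps_gt0.
have [/h|/ltW /h] := lerP (ofn m) (ofn n); first by [].
by rewrite distrC [eps n + _]addrC.
Qed.

Lemma realm_const (c : ratm M) : realm (fun=> c).
Proof. by move=> m n; rewrite subrr normr0 eps_gt0. Qed.

Lemma not_lem u v : ~ lem u v <-> exists n, v n + 2 * eps n < u n.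
Proof.
split=> [h|[n hn] /(_ n)]; last by rewrite leNgt hn.
apply: contrapT => hn; apply: h => n; rewrite leNgt; apply/negP => h.
by apply: hn; exists n.
Qed.

(** Trades the precision that witnesses a strict inequality for one rational gap usable at every
    precision. Moving both sequences from precision m to n costs 2 eps m, absorbed into [e], and 2
    eps n. *)
Lemma ltm_gap u v : realm u -> realm v -> ~ lem u v ->
  exists2 e, 0 < e & forall n, v n + e <= u n + 2 * eps n.
Proof.
move=> hu hv /not_lem [m hm]; exists (u m - v m - 2 * eps m); first lra.
move=> n; have := realm_dist m n hu; have := realm_dist m n hv.
rewrite !ler_norml => /andP [h1 h2] /andP [h3 h4]; lra.
Qed.

Lemma pos_gap u : posm_real u -> exists2 e, 0 < e & forall n, e - eps n <= u n.
Proof.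
move=> [hu /not_lem [m]]; rewrite add0r => hm; exists (eps m); first exact: eps_gt0.
by move=> n; have := realm_dist m n hu; rewrite ler_norml => /andP [h1 h2]; lra.
Qed.

Definition partm x t k :=
  [/\ eqm (vr (app x (0 : num M))) (fun=> 0), eqm (vr (app x k)) (fun=> 1),
    forall i, ofn i <= ofn k -> in01m (vr (app x i)) &
    forall i, ofn i < ofn k ->
      [/\ ~ lem (vr (app x (i + 1 : num M))) (vr (app x i)), in01m (vr (app t i)),
        lem (vr (app x i)) (vr (app t i)) & lem (vr (app t i)) (vr (app x (i + 1 : num M)))]].

Definition meshm x k u := forall i, ofn i < ofn k ->
  ~ lem u (fun n => vr (app x (i + 1 : num M)) (n + 1) - vr (app x i) (n + 1)).

(** The precision shift [s] stems from real multiplication; it depends on the summand, and only its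
    existence is recorded. *)
Definition is_rsum f x t k u := exists z,
  u = (fun n => sumv (column z (n + k)) k) /\
  forall i, exists s, vr (app z i) = fun n =>
    vr (app f (app t i)) (n + s) *
    (vr (app x (i + 1 : num M)) (n + s + 1) - vr (app x i) (n + s + 1)).

Lemma sat_partition (G : list ty) (r : env M G) (x t : tm G (N ⇒ T1)) (k : tm G N) :
  sat r (tagged_partition x t k) -> partm (eval r x) (eval r t) (eval r k).
Proof.
move=> [/sat_eqR h0 [/sat_eqR hk [h1 h2]]]; split.
- by move: h0; rewrite vr_natR eval_zero ofn0.
- by move: hk; rewrite vr_natR eval_one ofn1.
- move=> i hi; have : sat (econs i r : env M (N :: G)) (#0 ≼ k↑).
    by rewrite sat_not sat_lt lemE eval_wk.
  move/(h1 i)/(sat_in01 (econs i r : env M (N :: G)) (x↑ · #0)).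
  by rewrite eval_app eval_wk.
- move=> i hi; have : sat (econs i r : env M (N :: G)) (#0 ≺ k↑).
    by rewrite sat_lt ltmE eval_wk.
  move=> /(h2 i) [] /sat_ltR h3 [/sat_in01 h4 [/sat_leR h5 /sat_leR h6]].
  by split; move: h3 h4 h5 h6; rewrite ![eval _ (_↑ · _)]eval_app !eval_wk.
Qed.

Lemma sat_mesh (G : list ty) (r : env M G) (x : tm G (N ⇒ T1)) (k : tm G N) (d : tm G T1) :
  sat r (mesh_lt x k d) -> meshm (eval r x) (eval r k) (vr (eval r d)).
Proof.
move=> h i hi.
have : sat (econs i r : env M (N :: G)) (#0 ≺ k↑) by rewrite sat_lt ltmE eval_wk.
move=> /(h i)/(sat_ltR (econs i r : env M (N :: G)) (subR (x↑ · (#0 ⊕ 𝟏)) (x↑ · #0)) d↑).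
by rewrite vr_subR eval_wk ![eval _ (_↑ · _)]eval_app !eval_wk.
Qed.

Lemma sat_rsum (G : list ty) (r : env M G) (f : tm G (T1 ⇒ T1)) (x t : tm G (N ⇒ T1))
    (k : tm G N) :
  is_rsum (eval r f) (eval r x) (eval r t) (eval r k) (vr (eval r (riemann_sum f x t k))).
Proof.
rewrite /riemann_sum vr_sumR; set z := eval r (lam _); exists z; split => // i.
rewrite /z eval_lam.
have [s hs] := vr_mulR (econs i r : env M (N :: G)) (f↑ · (t↑ · #0)) (subR (x↑ · (#0 ⊕ 𝟏)) (x↑ · #0)).
by exists s; rewrite hs vr_subR ![eval _ (_↑ · _)]eval_app !eval_wk.
Qed.

Lemma sat_integralI (G : list ty) (r : env M G) (f : tm G (T1 ⇒ T1)) (J : tm G T1) :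
    realm (vr (eval r J)) ->
    (forall e, posm_real (vr e) -> exists d, posm_real (vr d) /\
      forall x t k u, partm x t k -> meshm x k (vr d) -> is_rsum (eval r f) x t k u ->
        ~ lem (vr e) (fun n => `|u (n + 1) - vr (eval r J) (n + 1)|)) ->
  sat r (is_integral f J).
Proof.
move=> hJ h; split; first exact/sat_is_real.
move=> e /sat_pos_real /h [d [hd hs]]; exists d; split; first exact/sat_pos_real.
move=> x t k [/sat_partition hp /sat_mesh hm]; apply/sat_ltR.
rewrite vr_absR vr_subR.
have := sat_rsum (econs k (econs t (econs x (econs d (econs e r)))) : env M [:: _, _, _, _, _ & G])
  f↑↑↑↑↑ #2 #1 #0.
rewrite !eval_wk; exact: hs.
Qed.

(** If j were at least i + 2, the chain t_i <= x_(i+1) < x_(i+2) <= x_j <= t_j would contradict the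
    equality of the tags. The chain is read at a single precision L whose total error is below the
    gap between x_(i+1) and x_(i+2). *)
Lemma part_separated x t k i j :
    partm x t k -> ofn i < ofn k -> ofn j < ofn k ->
    eqm (vr (app t i)) (vr (app t j)) ->
  ofn j <= ofn i + 1.
Proof.
move=> [_ _ hx ht] hi hj hij; rewrite leNgt; apply/negP => lt_ij.
have hx' a : ofn a <= ofn k -> realm (vr (app x a)) by move=> /hx [].
have l2 : ofn (i + 1 + 1) <= ofn j.
  by have := @ofn_ltS M (i + 1) j; rewrite !ofnE => h; apply: h; lra.
have [d ej] : exists d, j = i + 1 + 1 + d.
  by exists (monusm j (i + 1 + 1)); rewrite ltm_monus //; apply/lemE.
have hd := ofn_ge0 d.
(* Each of the d steps from x_(i+2) to x_j may lose 2 eps L at the fixed precision; the positive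
   gaps of these steps are discarded. *)
have mono L : vr (app x (i + 1 + 1 : num M)) L <= vr (app x j) L + ofn d * (2 * eps L).
  rewrite [in X in _ <= X]ej; apply: (ratm_ind (k := d)
    (f := fun=> vr (app x (i + 1 + 1 : num M)) L)
    (g := fun b => vr (app x (i + 1 + 1 + b : num M)) L + ofn b * (2 * eps L))) => //.
  - exact: defq_const.
  - apply: defq_add.
      exact: (defq_shift (f := fun b => vr (app x b) L) (i + 1 + 1) (defq_column x L)).
    by apply: defq_mul; [exact: defq_ofn | exact: defq_const].
  - by rewrite addr0 ofn0 mul0r addr0.
  - move=> b hb IH.
    have hb1 : ofn (i + 1 + 1 + b) < ofn k by move: hj; rewrite ej !ofnE; lra.
    have [lt_b _ _ _] := ht _ hb1.
    have [||e he /(_ L)] := ltm_gap _ _ lt_b; [apply: hx' | exact: hx' (ltW hb1) |].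
      by have := ofn_ltS hb1; rewrite (ofnD _ 1) ofn1.
    by rewrite !addrA (ofnD b) ofn1; lra.
have [_ _ _ ti] := ht _ hi; have [_ _ tj _] := ht _ hj.
have hi1 : ofn (i + 1) < ofn k by move: hj; rewrite ej !ofnE; lra.
have [lt_i _ _ _] := ht _ hi1.
have [||e he hgap] := ltm_gap _ _ lt_i; [apply: hx' | exact: hx' (ltW hi1) |].
  by rewrite (ofnD (i + 1)) ofn1; exact: ofn_ltS.
(* The two tag inequalities, the gap and the equality of the tags cost 2 eps L each, which makes 8;
   the d steps add 2 d. *)
have [||L hL] := @eps_lt (8 + 2 * ofn d) e; [lra | by [] |].
have := hgap L; have := mono L; have := ti L; have := tj L; have := hij L.
by rewrite ler_norml => /andP [h1 h2] h3 h4 h5 h6; lra.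
Qed.

End Integrals.

(** * Integrals of the constant 1 and of the indicator functions *)

Section Arzela.
Variable M : rmodel.
Implicit Types (a b i j k m n p : num M) (u v : num M -> ratm M).
Implicit Types (x t z : dom M (N ⇒ T1)) (y : dom M T1).

(** The sum telescopes up to 2 eps p per summand, in total 2 eps n, and the two endpoints contribute
    2 eps p each. *)
Lemma rsum_one (f : dom M (T1 ⇒ T1)) x t k u :
    (forall y, vr (app f y) = fun=> 1) -> partm x t k -> is_rsum f x t k u ->
  forall n, `|u n - 1| <= 6 * eps n.
Proof.
move=> hf [h0 h1 hx _] [z [-> hz]] n; set p := n + k.
have hp : eps p <= eps n := eps_addl n k.
(* Here the evaluation at precision n + k pays off: k summands cost k eps k <= 1 times eps n. *)
have hk : ofn k * eps p <= eps n.
  rewrite eps_add mulrCA -[leRHS]mulr1 ler_wpM2l ?ofn_eps //; exact: ltW (eps_gt0 n).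
have := @sumv_telescope M (column z p) (column x p) (2 * eps p) k.
rewrite !vr_column => h.
have {}h : `|sumv (column z p) k - (vr (app x k) p - vr (app x (0 : num M)) p)| <= ofn k * (2 * eps p).
  apply: h => i hi; have [s ->] := hz i; rewrite hf mul1r.
  have hi1 : ofn (i + 1) <= ofn k by have := ofn_ltS hi; rewrite ofnD ofn1.
  have [r1 _] := hx _ hi1; have [r0 _] := hx _ (ltW hi).
  have := r1 p (s + 1); have := r0 p (s + 1).
  by rewrite addrA !ltr_norml ler_norml => /andP [h2 h3] /andP [h4 h5]; lra.
have := h0 p; have := h1 p; have := eps_gt0 p; move: h.
by rewrite !ler_norml => /andP [h2 h3] h4 /andP [h5 h6] /andP [h7 h8]; lra.
Qed.

Lemma integral_one (G : list ty) (r : env M G) (f : tm G (T1 ⇒ T1)) (J : tm G T1) :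
    (forall y, vr (app (eval r f) y) = fun=> 1) -> vr (eval r J) = (fun=> 1) ->
  sat r (is_integral f J).
Proof.
move=> hf hJ; apply: sat_integralI; first by rewrite hJ; exact: realm_const.
(* The estimate [rsum_one] is uniform over all tagged partitions, so delta can be epsilon itself. *)
move=> e he; exists e; split => // x t k u hp _ hu.
have [c c0 hc] := pos_gap he; apply/not_lem; rewrite hJ.
(* The constant 9 is 6 from the Riemann sum, 2 from the strict order of reals and 1 from
   [pos_gap]. *)
have [||n hn] := @eps_lt M 9 c; [lra | by [] |]; exists n.
have := rsum_one hf hp hu (n + 1); have := eps_addl n 1; have := hc n; lra.
Qed.

(** The lower bound comes from the order of the division points, the upper one from the mesh; the
    latter is witnessed at some precision n + 1, and moving from there to [q] fits into the slack of
    the strict inequality. *)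
Lemma part_step x t k (d : ratm M) i q :
    0 <= d -> partm x t k -> meshm x k (fun=> d) -> ofn i < ofn k ->
  `|vr (app x (i + 1 : num M)) q - vr (app x i) q| <= d + 2 * eps q.
Proof.
move=> hd [_ _ hx ht] hm hi.
have hi1 : ofn (i + 1) <= ofn k by have := ofn_ltS hi; rewrite ofnD ofn1.
have [r1 _] := hx _ hi1; have [r0 _] := hx _ (ltW hi).
have [lt_i _ _ _] := ht _ hi.
have [e e0 /(_ q) he] := ltm_gap r1 r0 lt_i.
have /not_lem [n hn] := hm _ hi.
have := realm_dist q (n + 1) r1; have := realm_dist q (n + 1) r0.
rewrite epsS !ler_norml => /andP [h1 h2] /andP [h3 h4].
by have := eps_gt0 n; move: hn => /= hn hn0; apply/andP; split; lra.
Qed.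

Lemma rsum_indicator (f : dom M (T1 ⇒ T1)) (Y : dom M (T1 ⇒ N)) m (d : ratm M) x t k u :
    0 <= d -> (forall y, vr (app f y) = fun=> (ofn (app Y y : num M) <= ofn m)%R%:R) ->
    (forall y y', in01m (vr y) -> in01m (vr y') -> app Y y = app Y y' -> eqm (vr y) (vr y')) ->
    partm x t k -> meshm x k (fun=> d) -> is_rsum f x t k u ->
  forall n, `|u n| <= (d + 2 * eps n) * (3 * (ofn m + 1)).
Proof.
move=> hd hf hY hp hm [z [-> hz]] n; set p := n + k.
(* The values of [Y] at the tags must form an object of type 1 for the counting lemmas to apply. *)
pose w : dom M T1 :=
  eval (econs Y (econs t enil) : env M [:: T1 ⇒ N; N ⇒ T1]) (lam (#1 · (#2 · #0))).
have wE i : app w i = app Y (app t i) by rewrite /w eval_lam 2!eval_app.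
have D0 : 0 <= d + 2 * eps n by have := eps_gt0 n; lra.
apply: le_trans (_ : (d + 2 * eps n) * sumv (leqv w m) k <= _); last first.
  rewrite ler_wpM2l //; apply: count_le => i j hi hj; rewrite !wE => e.
  apply: (part_separated hp hi hj); have [_ _ _ ht] := hp.
  by have [_ ti _ _] := ht _ hi; have [_ tj _ _] := ht _ hj; exact: hY.
apply: sumv_dominated => i hi; rewrite vr_column vr_leqv wE.
have [s ->] := hz i; rewrite hf normrM normr_nat mulrC ler_wpM2r ?ler0n //.
apply: le_trans (part_step (p + s + 1) hd hp hm hi) _.
have : eps (p + s + 1) <= eps n by rewrite /p -!addrA; exact: eps_addl.
by lra.
Qed.

Lemma integral_indicator (G : list ty) (r : env M G) (f : tm G (T1 ⇒ T1)) (J : tm G T1)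
    (Y : dom M (T1 ⇒ N)) m :
    (forall y, vr (app (eval r f) y) = fun=> (ofn (app Y y : num M) <= ofn m)%R%:R) ->
    (forall y y', in01m (vr y) -> in01m (vr y') -> app Y y = app Y y' -> eqm (vr y) (vr y')) ->
    vr (eval r J) = (fun=> 0) ->
  sat r (is_integral f J).
Proof.
move=> hf hY hJ; apply: sat_integralI; first by rewrite hJ; exact: realm_const.
move=> e he; have [c c0 hc] := pos_gap he.
set C := 3 * (ofn m + 1); have hC : 0 < C by rewrite /C; have := ofn_ge0 m; lra.
(* With this mesh the main term d C is half of the gap [c]; the other half is left for the
   errors. *)
pose d := c / (2 * C); have d0 : 0 < d by rewrite divr_gt0 //; lra.
have dC : d * C = c / 2 by rewrite /d; field; rewrite gt_eqF.
(* Delta has to be a real of the model: the constant sequence of a code of [d]. *)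
have [q hq] := valq_surj d.
pose dl : dom M T1 := eval (econs q enil : env M [N]) (lam #1).
have dlE : vr dl = fun=> d by apply/funext => n; rewrite /vr /dl eval_lam.
exists dl; rewrite dlE; split.
  split; first exact: realm_const.
  apply/not_lem; have [||n hn] := @eps_lt M 2 d; [lra | by [] |].
  by exists n; rewrite add0r.
move=> x t k u hp hm hu; apply/not_lem; rewrite hJ.
(* The errors are 2 C eps n from the summands, 2 eps n from the strict order and eps n from
   [pos_gap]. *)
have [||n hn] := @eps_lt M (2 * C + 3) (c / 2); [lra | lra |].
exists n; rewrite subr0.
have := rsum_indicator (ltW d0) hf hY hp hm hu (n + 1); rewrite -/C mulrDl dC => h.
have h1 : 2 * eps (n + 1) * C <= 2 * eps n * C.
  by rewrite ler_wpM2r ?(ltW hC) // ler_wpM2l ?eps_addl.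
have h2 : (2 * C + 3) * eps n = 2 * eps n * C + 3 * eps n by ring.
by have := hc n; move: hn; rewrite h2; lra.
Qed.

End Arzela.

Opaque is_real eqR leR ltR in01 pos_real natR subR absR is_integral.

(** * The contradiction with Arzelà's theorem *)

Section Main.
Variable M : rmodel.
Implicit Types (a b i j k m n p : num M) (u v : num M -> ratm M).
Implicit Types y : dom M T1.

(** Meant for functions whose values are rationals coded by constant sequences, as the indicator
    functions are. *)
Lemma sat_real_fun (G : list ty) (r : env M G) (f : tm G (T1 ⇒ T1)) (h : dom M T1 -> ratm M) :
    (forall y, vr (app (eval r f) y) = fun=> h y) ->
    (forall y y', in01m (vr y) -> in01m (vr y') -> eqm (vr y) (vr y') -> h y = h y') ->
  sat r (real_fun f).
Proof.
move=> hf hh; split=> [y _|y y' [/sat_in01 hy [/sat_in01 hy' /sat_eqR e]]].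
  by apply/sat_is_real; rewrite eval_app eval_wk hf; exact: realm_const.
apply/sat_eqR; rewrite 2!eval_app !eval_wk !hf => n; rewrite (hh y y') // subrr normr0.
by have := eps_gt0 n; lra.
Qed.

Lemma sat_nat_fun (G : list ty) (r : env M G) (Y : tm G (T1 ⇒ N)) y y' :
    sat r (nat_fun Y) -> in01m (vr y) -> in01m (vr y') -> eqm (vr y) (vr y') ->
  app (eval r Y) y = app (eval r Y) y'.
Proof.
move=> h hy hy' e.
have : sat (econs y' (econs y r) : env M [:: T1, T1 & G]) (in01 #1 ⋏ in01 #0 ⋏ eqR #1 #0).
  by split; [apply/sat_in01 | split; [apply/sat_in01 | apply/sat_eqR]].
move=> /h /eq0_eq.
by rewrite -[eval _ (_ · #1)]/(app (eval _ Y↑↑) y) -[eval _ (_ · #0)]/(app (eval _ Y↑↑) y') !eval_wk.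
Qed.

Lemma Arz_NIN : sat (@enil M) (Arz ⊃ NIN).
Proof.
move=> hA Y hY; apply: contrapT => hn.
have injY y y' : in01m (vr y) -> in01m (vr y') -> app Y y = app Y y' -> eqm (vr y) (vr y').
  move=> hy hy' e; apply: contrapT => ne; apply: hn; exists y, y'.
  split; first exact/sat_in01.
  split; first exact/sat_in01.
  by split; [move=> /sat_eqR | apply/eq0_eq].
have eqY y y' : in01m (vr y) -> in01m (vr y') -> eqm (vr y) (vr y') -> app Y y = app Y y'.
  exact: (sat_nat_fun hY).
pose f : dom M (T1 ⇒ T1) := eval (@enil M) (lam (natR 𝟏)).
(* One term in [Y] gives the whole sequence: 1 monus (Y x monus n) is the indicator of Y x <= n. *)
pose F : dom M (N ⇒ T1 ⇒ T1) := eval (econs Y enil : env M [T1 ⇒ N])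
  (lam (lam (natR (monus 𝟏 (monus (#2 · #0) #1))))).
have fE y : vr (app f y) = fun=> 1 by rewrite /f eval_lam vr_natR eval_one ofn1.
have FE n y : vr (app (app F n) y) = fun=> (ofn (app Y y : num M) <= ofn n)%R%:R.
  by rewrite /F 2!eval_lam vr_natR 2!eval_monus eval_one eval_app ofn_monus1.
pose nr (a : num M) : dom M T1 := eval (econs a enil : env M [N]) (natR #0).
have nrE a : vr (nr a) = fun=> ofn a by rewrite /nr vr_natR.
have nr0 : vr (nr 0) = fun=> 0 by rewrite nrE ofn0.
have nr1 : vr (nr 1) = fun=> 1 by rewrite nrE ofn1.
have FY n y y' : in01m (vr y) -> in01m (vr y') -> eqm (vr y) (vr y') ->
    (ofn (app Y y : num M) <= ofn n)%R%:R = (ofn (app Y y' : num M) <= ofn n)%R%:R :> ratm M.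
  by move=> hy hy' e; rewrite (eqY y y').
have pos1 : posm_real (vr (nr 1)).
  rewrite nr1; split; first exact: realm_const.
  apply/not_lem; have [||n hl] := @eps_lt M 2 1; [lra | lra |].
  by exists n; rewrite add0r.
pose r : env M [:: N ⇒ T1 ⇒ T1; T1 ⇒ T1] := econs F (econs f enil).
have int_F (n : num M) G (r' : env M G) (g : tm G (T1 ⇒ T1)) (J : tm G T1) :
    eval r' g = app F n -> eval r' J = nr 0 -> sat r' (is_integral g J).
  move=> eg eJ; apply: (integral_indicator (Y := Y) (m := n)) => //.
  + by move=> y; rewrite eg FE.
  + by rewrite eJ nr0.
have int_f G (r' : env M G) (g : tm G (T1 ⇒ T1)) (J : tm G T1) :
    eval r' g = f -> eval r' J = nr 1 -> sat r' (is_integral g J).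
  by move=> eg eJ; apply: integral_one => [y|]; rewrite ?eg ?eJ ?fE ?nr1.
have h1 : sat r ((real_fun #1 ⋏ integrable #1)
    ⋏ (∀[N] real_fun (#1 · #0) ⋏ integrable (#1 · #0)) ⋏ pointwise_lim #0 #1).
  split; [split|split].
  - by apply: (sat_real_fun (h := fun=> 1)) => // y; exact: fE.
  - by exists (nr 1); apply: int_f.
  - move=> n; split; last by exists (nr 0); apply: (int_F n).
    apply: (sat_real_fun (h := fun y => (ofn (app Y y : num M) <= ofn n)%R%:R)) => [y|y y'].
      exact: FE.
    exact: FY.
  (* The index [app Y y] serves every epsilon, since from there on the value is exactly 1. *)
  - move=> y _ e /sat_pos_real [_ he]; exists (app Y y) => n hn'; apply/sat_ltR.
    rewrite vr_absR vr_subR.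
    have -> : vr (eval (econs n (econs (app Y y) (econs e (econs y r))) : env M [:: N, N, T1, T1 & _])
        (#0↑↑↑↑ · #0 · #3)) = fun=> 1.
      have {}hn' : ofn (app Y y : num M) <= ofn n by apply/lemE.
      rewrite -[eval _ _]/(app (app F n) y) FE.
      by apply/funext => q; rewrite hn'.
    rewrite -[eval _ (#1↑↑↑↑ · #3)]/(app f y) fE.
    by move=> hl; apply: he; move: hl; congr lem; apply/funext => q; rewrite subrr normr0.
have h2 : sat r (∃[N] bounded_by #1 #0).
  (* The bound in the theorem is M + 1, so M = 0 covers indicator functions. *)
  exists (0 : num M) => n y _; apply/sat_leR; rewrite vr_absR vr_natR.
  rewrite -[eval _ (_ · #1 · #0)]/(app (app F n) y) FE => q.
  rewrite -[eval _ (_ ⊕ 𝟏)]/((0 : num M) + 1) add0r ofn1 normr_nat.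
  by have := eps_gt0 q; have := lern1 (ratm M) (ofn (app Y y : num M) <= ofn n)%R;
    rewrite leq_b1; lra.
have H : sat r (integrals_lim #0 #1) := hA f F h1 h2.
have i1 : sat (econs (nr 1) r : env M [:: T1 & _]) (is_integral #1↑ #0) by apply: int_f.
(* Epsilon is 1, exactly the distance between the integrals 0 and the limit 1, so the strict
   inequality fails. *)
have p1 : sat (econs (nr 1) (econs (nr 1) r) : env M [:: T1, T1 & _]) (pos_real #0).
  exact/sat_pos_real.
have [n hn'] := H (nr 1) i1 (nr 1) p1.
have i0 : sat (econs (nr 0) (econs n (econs n (econs (nr 1) (econs (nr 1) r)))) :
    env M [:: T1, N, N, T1, T1 & _]) (is_integral (#0↑↑↑↑↑ · #1) #0) by apply: (int_F n).
(* The index supplied by the limit statement is itself taken as the later index. *)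
have /sat_ltR := hn' n (@ltm_irrefl M n) (nr 0) i0.
rewrite vr_absR vr_subR => hl; apply: hl => q.
rewrite -[eval _ #3]/(nr 1) -[eval _ #4]/(nr 1) -[eval _ #0]/(nr 0) nr1 nr0.
by rewrite sub0r normrN normr1; have := eps_gt0 q; lra.
Qed.

End Main.

Theorem theorem3p6 : proves RCA0w (Arz ⊃ NIN).
Proof.
apply: RCA0w_complete => M; have [R <-] := rmodel_ex M.
exact: Arz_NIN.
Qed.
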